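(* Consider the system $\dot x_1 = g_1(x_1)x_2$, $\dot x_2 = f_2(x_1,x_2)+g_2(x_1,x_2)u$, and the corresponding transformed system $\dot z_1=\mathcal G_1(z_1,z_2)$, $\dot z_2=\mathcal F_2(z_1,z_2)+\mathcal G_2(z_1,z_2)u$, as defined in the context. Assume that the initial condition is inside the safe set, that is, $(x_1(0),x_2(0))\in\mathcal S$, and let $x_{1\mathrm d}\in\mathbb R^n$ satisfy $|x_{1\mathrm d}|<\overline x_1$ (componentwise). Let $k_1>0$, $k_2=k_1^{-1}$, and consider the control law $$u=-\mathcal G_2(z_1,z_2)^{-1}\Big(\mathcal F_2(z_1,z_2)+k_2 D(\overline x_2)\Phi(\zeta_1)^{\mathrm T}e_2\Big).$$ Then $$\lim_{t\to\infty}z_1(t)=z_{1\mathrm d},\qquad \lim_{t\to\infty}z_2(t)=0,\qquad \lim_{t\to\infty}u(t)=0,\qquad \lim_{t\to\infty}x_1(t)=x_{1\mathrm d},$$ and $(x_1(t),x_2(t))\in\mathcal S$ for all $t\ge 0$.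
   Context: Notation. For $q\in\mathbb R^n$, $D(q)=\mathrm{diag}(q_1,\dots,q_n)$, and if all $q_i\ne0$, $D_{\mathrm I}(q)=\mathrm{diag}(q_1^{-1},\dots,q_n^{-1})$. Let $\mathcal C=\{x\in\mathbb R^n:\|x\|_\infty<1\}$. Inequalities and absolute values of vectors are componentwise. System. $x_1,x_2,u\in\mathbb R^n$; $g_1:\mathbb R^n\to\mathbb R^{n\times n}$, $f_2:\mathbb R^n\times\mathbb R^n\to\mathbb R^n$, $g_2:\mathbb R^n\times\mathbb R^n\to\mathbb R^{n\times n}$ are continuously differentiable (of sufficient order). Let $\overline x_1,\overline x_2\in\mathbb R^n$ have strictly positive components, and let the safe set be $\mathcal S=\{(x_1,x_2)\in\mathbb R^n\times\mathbb R^n:|x_1|<\overline x_1,\ |x_2|<\overline x_2\}$. Standing assumptions. (i) $f_2(x_1,x_2)=0$ if and only if $x_2=0$. (ii) $g_1(x_1)$ and $g_2(x_1,x_2)$ are nonsingular for all $(x_1,x_2)\in\mathcal S$. Sigmoids. A simple sigmoid is a function $\sigma:\mathbb R\to(-1,1)$ that is $C^\infty$, odd, satisfies $\lim_{x\to\infty}\sigma(x)=1$, and such that $\sigma(x)/x$ is completely convex on $(0,1)$ (i.e. $(-1)^k$ times its $2k$-th derivative is nonnegative there for all $k\ge0$). It is strictly increasing if $\sigma'(x)>0$ for all $x\in\mathbb R$. Fix strictly increasing simple sigmoids $\sigma_1,\dots,\sigma_n$ with inverses $\eta_i=\sigma_i^{-1}:(-1,1)\to\mathbb R$. The constraint-lifting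 function is $\phi:\mathcal C\to\mathbb R^n$, $\phi(\chi)=(\eta_1(\chi_1),\dots,\eta_n(\chi_n))^{\mathrm T}$, with Jacobian $\partial\phi(\chi)$, and its inverse is $\psi:\mathbb R^n\to\mathcal C$, $\psi(z)=(\sigma_1(z_1),\dots,\sigma_n(z_n))^{\mathrm T}$. Transformation. For $j=1,2$: $\chi_j=D_{\mathrm I}(\overline x_j)x_j$, $z_j=D(\overline x_j)\phi(\chi_j)$, $\zeta_j=D_{\mathrm I}(\overline x_j)z_j$, so $x_j=D(\overline x_j)\psi(\zeta_j)$. In these coordinates the system reads $\dot z_1=\mathcal G_1(z_1,z_2)$, $\dot z_2=\mathcal F_2(z_1,z_2)+\mathcal G_2(z_1,z_2)u$, where $\Phi(\zeta_1)=[\partial\phi(\psi(\zeta_1))]\,g_1(D(\overline x_1)\psi(\zeta_1))\,D(\overline x_2)$, $\mathcal G_1(z_1,z_2)=\Phi(\zeta_1)\psi(\zeta_2)$, $\mathcal F_2(z_1,z_2)=[\partial\phi(\psi(\zeta_2))]\,f_2(D(\overline x_1)\psi(\zeta_1),D(\overline x_2)\psi(\zeta_2))$, $\mathcal G_2(z_1,z_2)=[\partial\phi(\psi(\zeta_2))]\,g_2(D(\overline x_1)\psi(\zeta_1),D(\overline x_2)\psi(\zeta_2))$. Errors. $z_{1\mathrm d}=D(\overline x_1)\phi(D_{\mathrm I}(\overline x_1)x_{1\mathrm d})$, $e_1=z_1-z_{1\mathrm d}$, $e_2=\Phi(\zeta_1)\psi(\zeta_2)+k_1e_1$. *)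

(* Defs.v *)
From HB Require Import structures.
From mathcomp Require Import all_boot all_order all_algebra.
From mathcomp Require Import all_classical all_reals all_analysis.

Set Implicit Arguments.
Unset Strict Implicit.
Unset Printing Implicit Defensive.

Import Order.TTheory GRing.Theory Num.Theory.
Import numFieldNormedType.Exports.

Local Open Scope classical_set_scope.
Local Open Scope ring_scope.

Definition D (R : realType) (n : nat) (q : 'cV[R]_n) : 'M[R]_n :=
  diag_mx q^T.

Definition DI (R : realType) (n : nat) (q : 'cV[R]_n) : 'M[R]_n :=
  diag_mx (\row_i (q i 0)^-1).

Definition safe (R : realType) (n : nat) (xb1 xb2 : 'cV[R]_n) :
    set ('cV[R]_n * 'cV[R]_n) :=
  [set x : 'cV[R]_n * 'cV[R]_n | (forall i, `|x.1 i 0| < xb1 i 0) /\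
           (forall i, `|x.2 i 0| < xb2 i 0)].

(* In finite dimension, continuity of x |-> 'd f x v for every v is the same
   as continuity of x |-> 'd f x for the operator norm. *)
Definition continuously_differentiable (R : realType) (U V : normedModType R)
    (f : U -> V) : Prop :=
  (forall x, differentiable f x) /\ (forall v, continuous (fun x => 'd f x v)).

(* The quotient takes the value 0 at 0, but its derivatives are only evaluated
   on the open interval ]0, 1[, where that value has no influence. *)
Definition simple_sigmoid (R : realType) (s : R -> R) : Prop :=
  [/\ forall x, -1 < s x < 1,
      forall (k : nat) (x : R), derivable (s^`(k))%classic x 1,
      forall x, s (- x) = - s x,
      s x @[x --> +oo] --> (1 : R) &
      forall (k : nat) (x : R), 0 < x < 1 ->
        0 <= (-1) ^+ k * ((fun y => s y / y)^`(k.*2))%classic x].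

Definition strictly_increasing_sigmoid (R : realType) (s : R -> R) : Prop :=
  simple_sigmoid s /\ (forall x, 0 < (s^`())%classic x).

(* The inverse of s on its range, which is ]-1, 1[ for a strictly increasing
   simple sigmoid; outside that range the value is a dummy. *)
Definition eta (R : realType) (s : R -> R) : R -> R :=
  'pinv_(fun=> 0) setT s.

Definition phi (R : realType) (n : nat) (sigma : 'I_n -> R -> R)
    (chi : 'cV[R]_n) : 'cV[R]_n :=
  \col_i eta (sigma i) (chi i 0).

Definition psi (R : realType) (n : nat) (sigma : 'I_n -> R -> R)
    (z : 'cV[R]_n) : 'cV[R]_n :=
  \col_i sigma i (z i 0).

(* The library's [jacobian] acts on row vectors and is the transpose of the
   usual matrix of partial derivatives, hence this version. *)
Definition Jac (R : realType) (n : nat) (f : 'cV[R]_n -> 'cV[R]_n)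
    (x : 'cV[R]_n) : 'M[R]_n :=
  \matrix_(i, j) 'D_(delta_mx j 0) (fun y => f y i 0) x.

(* z = D(xb) phi(DI(xb) x), meaningful when |x| < xb componentwise. *)
Definition lifted (R : realType) (n : nat) (sigma : 'I_n -> R -> R)
    (xb x : 'cV[R]_n) : 'cV[R]_n :=
  D xb *m phi sigma (DI xb *m x).

Section ControlLaw.
Context (R : realType) (n : nat) (sigma : 'I_n -> R -> R).
Context (g1 : 'cV[R]_n -> 'M[R]_n).
Context (f2 : 'cV[R]_n * 'cV[R]_n -> 'cV[R]_n).
Context (g2 : 'cV[R]_n * 'cV[R]_n -> 'M[R]_n).
Context (xb1 xb2 : 'cV[R]_n).

Definition Phi (zeta1 : 'cV[R]_n) : 'M[R]_n :=
  Jac (phi sigma) (psi sigma zeta1) *m g1 (D xb1 *m psi sigma zeta1) *m D xb2.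

Definition F2 (z1 z2 : 'cV[R]_n) : 'cV[R]_n :=
  let zeta1 := DI xb1 *m z1 in
  let zeta2 := DI xb2 *m z2 in
  Jac (phi sigma) (psi sigma zeta2) *m
    f2 (D xb1 *m psi sigma zeta1, D xb2 *m psi sigma zeta2).

Definition G2 (z1 z2 : 'cV[R]_n) : 'M[R]_n :=
  let zeta1 := DI xb1 *m z1 in
  let zeta2 := DI xb2 *m z2 in
  Jac (phi sigma) (psi sigma zeta2) *m
    g2 (D xb1 *m psi sigma zeta1, D xb2 *m psi sigma zeta2).

Definition control (k1 k2 : R) (x1d z1 z2 : 'cV[R]_n) : 'cV[R]_n :=
  let zeta1 := DI xb1 *m z1 in
  let zeta2 := DI xb2 *m z2 in
  let e1 := z1 - lifted sigma xb1 x1d in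
  let e2 := Phi zeta1 *m psi sigma zeta2 + k1 *: e1 in
  - (invmx (G2 z1 z2) *m
       (F2 z1 z2 + k2 *: (D xb2 *m (Phi zeta1)^T *m e2))).

(* Trajectories on [0, T[, with T possibly +oo. *)
Definition plant_solution (T : \bar R) (u x1 x2 : R -> 'cV[R]_n) : Prop :=
  [/\ x1 t @[t --> 0^'+] --> x1 0,
      x2 t @[t --> 0^'+] --> x2 0 &
      forall t : R, 0 < t -> (t%:E < T)%E ->
        is_derive t 1 x1 (g1 (x1 t) *m x2 t) /\
        is_derive t 1 x2 (f2 (x1 t, x2 t) + g2 (x1 t, x2 t) *m u t)].

(* The feedback is only defined on the safe set, so the input is left
   unconstrained at times when the state is outside it: staying in the safe
   set is thus not part of the definition. *)
Definition closed_loop (k1 k2 : R) (x1d : 'cV[R]_n) (T : \bar R)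
    (u x1 x2 : R -> 'cV[R]_n) : Prop :=
  plant_solution T u x1 x2 /\
  forall t : R, 0 <= t -> (t%:E < T)%E -> safe xb1 xb2 (x1 t, x2 t) ->
    u t = control k1 k2 x1d (lifted sigma xb1 (x1 t)) (lifted sigma xb2 (x2 t)).

End ControlLaw.

(* Main.v *)
Require Import Defs.
From HB Require Import structures.
From mathcomp Require Import all_boot all_order all_algebra.
From mathcomp Require Import all_classical all_reals all_analysis.
From mathcomp Require Import ring lra.
Import Order.TTheory GRing.Theory Num.Theory.
Import numFieldNormedType.Exports.
(**
  Measure the position by the lifted error [e = z1 - z1d] and the velocity by
  [zeta2], and write [A = Phi zeta1] and [v = psi zeta2].  Since [G2] is
  invertible on the safe set, the control law turns the plant into
    [e' = A v]     and     [zeta2' = - A^T (e + k2 A v)].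
  The choice [k2 = 1 / k1] makes the cross terms cancel in the energy
    [V = |e|^2 / 2 + sum_i (a primitive of sigma_i) (zeta2_i)],
  whose derivative along the flow is [- k2 |A v|^2 <= 0] ([energy_identity]).
  Both kinds of terms of [V] grow at least linearly, so bounded energy means
  bounded lifted coordinates, that is, a state in a compact part of the safe set.

  Global existence.  The field is only locally Lipschitz.  Clipping every
  coordinate to [[-r, r]] before evaluating the field makes it globally
  Lipschitz, so that Picard iteration ([picard_lindelof]) gives a solution for
  all times.  The energy identity is an algebraic identity at a point, hence it
  holds at the clipped point too: if the primitives of the clipped slopes are
  used as potentials, the modified energy decreases along the whole truncated
  flow, whether or not the clipping is active.  Its growth bound does not depend
  on [r], so for large [r] the truncated solution never reaches the clipping
  level, and it solves the original system ([bounded_solution_exists]).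

  Convergence.  All quantities are Lipschitz in time along the bounded solution.
  The energy converges, so by Barbalat's lemma [A v -> 0]; as [g1] is invertible
  with bounded inverse on the relevant compact set, [v -> 0] and [zeta2 -> 0].
  A second use of Barbalat's lemma, for [zeta2], gives [zeta2' -> 0], hence
  [A^T e -> 0] and [e -> 0].  For the input, [g2 u] is the difference of [x2']
  and [f2 (x1, x2)]; both tend to [0] because [f2 (x1d, 0) = 0].

  Uniqueness.  A closed-loop trajectory is not assumed to stay safe.  Up to the
  last time at which it agrees with the constructed solution it is safe, hence
  safe for a little longer, and there its lifted coordinates solve the truncated
  Lipschitz equation, which forces agreement to persist ([agreement_step]).
*)

Set Implicit Arguments.
Unset Strict Implicit.
Unset Printing Implicit Defensive.
Local Open Scope classical_set_scope.
Local Open Scope ring_scope.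

(** * Differential calculus on the line *)

Section OneVariable.
Context {R : realType}.
Implicit Types (f g df : R -> R) (a b t x : R).

Lemma is_derive_continuous (W : normedModType R) (h : R -> W) (d : W) x :
  is_derive x 1 h d -> {for x, continuous h}.
Proof. by move=> [fx _]; exact/differentiable_continuous/derivable1_diffP. Qed.

Lemma is_derive1D f g (df dg : R) x : is_derive x 1 f df -> is_derive x 1 g dg ->
  is_derive x 1 (fun t => f t + g t) (df + dg).
Proof. by move=> ? ?; exact: is_deriveD. Qed.

Lemma is_derive1B f g (df dg : R) x : is_derive x 1 f df -> is_derive x 1 g dg ->
  is_derive x 1 (fun t => f t - g t) (df - dg).
Proof. by move=> ? ?; exact: is_deriveB. Qed.

Lemma is_derive1M f g (df dg : R) x : is_derive x 1 f df -> is_derive x 1 g dg ->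
  is_derive x 1 (fun t => f t * g t) (df * g x + f x * dg).
Proof.
move=> fd gd; apply: (is_derive_eq (is_deriveM fd gd)).
by rewrite addrC; congr (_ + _); exact: mulrC.
Qed.

Lemma is_derive1Z f (df c : R) x : is_derive x 1 f df ->
  is_derive x 1 (fun t => c * f t) (c * df).
Proof. by move=> ?; exact: is_deriveZ. Qed.

Lemma is_derive1_sum (I : Type) (r : seq I) (f : I -> R -> R) (df : I -> R) x :
  (forall i, is_derive x 1 (f i) (df i)) ->
  is_derive x 1 (fun t => \sum_(i <- r) f i t) (\sum_(i <- r) df i).
Proof.
move=> fd; elim: r => [|i r IH].
  under eq_fun do rewrite big_nil; rewrite big_nil; exact: is_derive_cst.
under eq_fun do rewrite big_cons; rewrite big_cons; exact: is_derive1D.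
Qed.

Lemma derive_continuous_within f df a b :
  (forall x, a <= x <= b -> is_derive x 1 f (df x)) -> {within `[a, b], continuous f}.
Proof.
move=> fd; apply: continuous_in_subspaceT => x /set_mem/=; rewrite in_itv/= => xab.
exact: (is_derive_continuous (fd _ xab)).
Qed.

Lemma nonincreasing_derive f df a b : a <= b ->
  {within `[a, b], continuous f} ->
  (forall x, a < x < b -> is_derive x 1 f (df x)) ->
  (forall x, a < x < b -> df x <= 0) -> f b <= f a.
Proof.
rewrite le_eqVlt => /predU1P[-> //|ab] fc fd df0.
have fd' x : x \in `]a, b[ -> is_derive x 1 f (df x) by rewrite in_itv; exact: fd.
have [c /[!in_itv]/= cab E] := MVT ab fd' fc.
by rewrite -subr_le0 E mulr_le0_ge0 ?df0// subr_ge0 ltW.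
Qed.

Lemma cvg_within_itvl f a b : a <= b -> f x @[x --> a^'+] --> f a ->
  (forall x, a < x -> x <= b -> {for x, continuous f}) -> {within `[a, b], continuous f}.
Proof.
rewrite le_eqVlt => /predU1P[<- _ _|ab fa fc].
  by rewrite set_itv1; exact: continuous_subspace1.
apply/(continuous_within_itvP _ ab); split => //.
- by move=> x; rewrite in_itv/= => /andP[ax /ltW xb]; exact: fc.
- by apply: cvg_at_left_filter; exact: fc.
Qed.

(** Comparing derivatives replaces every integral estimate of the sequel: the
    majorant [g] is chosen with the wanted growth. *)
Lemma norm_le_derive f g df dg a b : a <= b ->
  {within `[a, b], continuous f} -> {within `[a, b], continuous g} ->
  (forall x, a < x < b -> is_derive x 1 f (df x)) ->
  (forall x, a < x < b -> is_derive x 1 g (dg x)) ->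
  (forall x, a < x < b -> `|df x| <= dg x) ->
  `|f b - f a| <= g b - g a.
Proof.
move=> ab fc gc fd gd dfg.
have H1 : (f - g) b <= (f - g) a.
  apply: (@nonincreasing_derive _ (fun x => df x - dg x)) => //.
  - by move=> x; apply: cvgB; [exact: fc|exact: gc].
  - by move=> x xab; have := fd x xab; have := gd x xab => ? ?; exact: is_deriveB.
  - by move=> x xab; rewrite subr_le0 (le_trans (ler_norm _)) ?dfg.
have H2 : (- f - g) b <= (- f - g) a.
  apply: (@nonincreasing_derive _ (fun x => - df x - dg x)) => //.
  - by move=> x; apply: cvgB; [apply: cvgN; exact: fc|exact: gc].
  - by move=> x xab; have := fd x xab; have := gd x xab => ? ?; exact: is_deriveB.
  - by move=> x xab; rewrite subr_le0 (le_trans (ler_norm _)) ?normrN ?dfg.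
move: H1 H2; rewrite !fctE => H1 H2.
rewrite ler_norml; lra.
Qed.

Let mu := @lebesgue_measure R.

Lemma segment_primitive q (N : R) : continuous q -> 
  exists2 G : R -> R, G 0 = 0 & forall x, - N < x < N -> is_derive x 1 G (q x).
Proof.
move=> qc.
pose G y := (\int[mu]_(t in `[- N, y]) (q t))%R.
exists (fun y => G y - G 0); first by rewrite subrr.
move=> x /andP[Nx xN].
have qi : mu.-integrable `[- N, N] (EFin \o q).
  apply: continuous_compact_integrable; first exact: segment_compact.
  exact: continuous_subspaceT.
have [dG GE] := @continuous_FTC1_closed _ q (- N) x N xN qi Nx (qc x).
have ? : is_derive x 1 G (q x) by split; [exact: dG|rewrite -derive1E].
rewrite -[q x]subr0; exact: is_deriveB.
Qed.

Lemma eq_derive_segment f g df (N : R) x :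
  (forall y, - N < y < N -> is_derive y 1 f (df y)) ->
  (forall y, - N < y < N -> is_derive y 1 g (df y)) ->
  f 0 = g 0 -> - N < x < N -> f x = g x.
Proof.
move=> fd gd fg0 /andP[Nx xN].
have cf y : - N < y < N -> {for y, continuous f}.
  by move=> /fd; exact: is_derive_continuous.
have cg y : - N < y < N -> {for y, continuous g}.
  by move=> /gd; exact: is_derive_continuous.
have sub0 a b : - N < a -> a <= b -> b < N -> f b - f a = g b - g a.
  move=> Na ab bN; apply/eqP; rewrite -subr_eq0 -normr_le0.
  have -> : f b - f a - (g b - g a) = (f - g) b - (f - g) a by rewrite !fctE; ring.
  rewrite -(subrr (0 : R)).
  apply: (@norm_le_derive _ (fun=> 0) (fun x => df x - df x) (fun=> 0)) => //.
  - apply: continuous_in_subspaceT => y /set_mem/=; rewrite in_itv/= => /andP[ay yb].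
    by apply: cvgB; [apply: cf|apply: cg]; lra.
  - by move=> y; exact: cvg_cst.
  - move=> y yab; have yN : - N < y < N by lra.
    by have ? := fd y yN; have ? := gd y yN; exact: is_deriveB.
  - by move=> y _; rewrite subrr normr0.
have [x0|x0] := leP 0 x.
  have := sub0 0 x; rewrite fg0 => H; have := H _ x0 xN; lra.
have := sub0 x 0; rewrite fg0 => H; have := H Nx (ltW x0); lra.
Qed.

(** A primitive on the whole line is glued from primitives on the symmetric
    segments [[-N, N]]; they agree where they overlap because all vanish at 0. *)
Lemma primitive_exists q : continuous q ->
  exists2 G : R -> R, G 0 = 0 & forall x, is_derive x 1 G (q x).
Proof.
move=> qc.
have /choice[G GP] : forall N : R, exists G : R -> R, G 0 = 0 /\
    forall x, - N < x < N -> is_derive x 1 G (q x).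
  by move=> N; have [G] := segment_primitive N qc; exists G.
exists (fun x => G (`|x| + 1) x); first by case: (GP (`|0 : R| + 1)).
move=> x.
have [GN0 GN] := GP (`|x| + 2).
have dG : is_derive x 1 (G (`|x| + 2)) (q x) by apply: GN; rewrite -ltr_norml ltrDl.
apply: (near_eq_is_derive _ dG).
near=> y.
have [GM0 GM] := GP (`|y| + 1).
have yx : `|y| < `|x| + 1.
  have -> : y = x - (x - y) by ring.
  rewrite (le_lt_trans (ler_normB _ _))// ltrD2l.
  by near: y; exists 1 => /=.
apply: (@eq_derive_segment _ _ q (`|y| + 1)) => //.
- move=> z; rewrite -!ltr_norml => zy; apply: GN; rewrite -ltr_norml; lra.
- by rewrite GN0 GM0.
- by rewrite -ltr_norml ltrDl.
Unshelve. all: by end_near. Qed.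

End OneVariable.

(** * Existence and uniqueness for Lipschitz differential equations *)

Section Geometric.
Context {R : realType}.

Lemma geometric_cauchy_limit (u : nat -> R) (c : R) :
  (forall k, `|u k.+1 - u k| <= c / 2 ^+ k) ->
  exists l, forall k, `|u k - l| <= 2 * c / 2 ^+ k.
Proof.
move=> uc.
pose r k := 2 * c / 2 ^+ k.
have rS k : r k = r k.+1 + c / 2 ^+ k.
  rewrite /r exprS; field; exact: expf_neq0.
have c0 k : 0 <= r k.+1.
  have := le_trans (normr_ge0 _) (uc k); rewrite /r exprS => h.
  by have -> : 2 * c / (2 * 2 ^+ k) = c / 2 ^+ k by field; exact: expf_neq0.
have r0 k : 0 <= r k.
  by rewrite rS addr_ge0// (le_trans (normr_ge0 _) (uc k)).
have H k m : `|u (k + m)%N - u k| <= r k - r (k + m)%N.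
  elim: m => [|m IH]; first by rewrite addn0 !subrr normr0.
  have -> : u (k + m.+1)%N - u k = (u (k + m.+1)%N - u (k + m)%N) + (u (k + m)%N - u k) by ring.
  rewrite (le_trans (ler_normD _ _))//.
  have := uc (k + m)%N; have := rS (k + m)%N; rewrite addnS => E ?; lra.
pose S := range (fun k => u k - r k).
have Sub k x : S x -> x <= u k + r k.
  move=> [m _ <-]; have [mk|/ltnW km] := leqP m k.
    have := H m (k - m)%N; rewrite subnKC// ler_norml; have := r0 k; lra.
  have := H k (m - k)%N; rewrite subnKC// ler_norml; have := r0 m; lra.
exists (sup S) => k.
have S0 : S !=set0 by exists (u 0%N - r 0%N), 0%N.
have h1 : sup S <= u k + r k by apply: ge_sup => // x; exact: Sub.
have h2 : u k - r k <= sup S.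
  apply: ub_le_sup; last by exists k.
  by exists (u 0%N + r 0%N) => x; exact: Sub.
rewrite ler_norml /r in h1 h2 *; lra.
Qed.

End Geometric.

(** Lipschitz continuity for the sup distance on [I -> R]; the bound [M] is a
    parameter, which avoids computing a maximum over [I]. *)
Definition sup_lipschitz {R : realType} (I : Type) (L : R) (F : (I -> R) -> I -> R) :=
  forall x y M, (forall i, `|x i - y i| <= M) ->
    forall i, `|F x i - F y i| <= L * M.

Section Picard.
Context {R : realType} (I : finType) (F : (I -> R) -> I -> R) (L : R) (x0 : I -> R).
Hypothesis (L0 : 0 < L) (FL : sup_lipschitz L F).

(* Clipping time at 0 extends the right-hand side to negative times, so that
   primitives on the whole line can be used. *)
Let field_along (x : R -> I -> R) (i : I) (t : R) := F (x (Num.max t 0)) i.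

Lemma continuous_field_along (x : R -> I -> R) : (forall i, continuous (fun t : R => x (Num.max t 0) i)) ->
  forall i, continuous (field_along x i).
Proof.
move=> xc i t; apply/cvgrPdist_le => e e0.
have H : \forall s \near t, forall j, `|x (Num.max t 0) j - x (Num.max s 0) j| <= e / L.
  apply: (@filter_forall R I (fun j s => `|x (Num.max t 0) j - x (Num.max s 0) j| <= e / L) (nbhs t)) => j.
  have /cvgrPdist_le/(_ (e / L)) := xc j t; apply; exact: divr_gt0.
near=> s.
have -> : e = L * (e / L) by field; exact: lt0r_neq0.
by apply: FL; near: s.
Unshelve. all: by end_near. Qed.

Lemma continuous_max0 (f : R -> R) : continuous f -> continuous (fun t : R => f (Num.max t 0)).
Proof.
move=> fc t; apply: (@continuous_comp _ _ _ (fun t : R => Num.max t 0) f); last exact: fc.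
apply: continuous_max; [exact: cvg_id|exact: cvg_cst].
Qed.

Let step (x : {x : R -> I -> R | forall i, continuous (x^~ i)}) :
  exists y : {x : R -> I -> R | forall i, continuous (x^~ i)},
    (forall i, sval y 0 i = x0 i) /\
    forall i (t : R), is_derive t 1 ((sval y)^~ i) (field_along (sval x) i t).
Proof.
case: x => x xc /=.
have fc := continuous_field_along (fun i => continuous_max0 (xc i)).
have /choice[G GP] : forall i, exists G : R -> R, G 0 = 0 /\
    forall t : R, is_derive t 1 G (field_along x i t).
  by move=> i; have [G] := primitive_exists (fc i); exists G.
have yd i (t : R) : is_derive t 1 (fun s => x0 i + G i s) (field_along x i t).
  have [_ /(_ t) ?] := GP i.
  rewrite -[X in is_derive _ _ _ X]add0r; exact: is_deriveD.
have yc i : continuous (fun s => x0 i + G i s).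
  by move=> t; exact: is_derive_continuous (yd i t).
exists (exist _ (fun s i => x0 i + G i s) yc); split => //= i.
by have [-> _] := GP i; rewrite addr0.
Qed.

Lemma is_derive_cst_expR (c a t : R) : is_derive t 1 (fun s : R => c * expR (a * s)) (c * (a * expR (a * t))).
Proof.
have d1 : is_derive t 1 (fun s : R => a * s) (a * 1) by exact: is_deriveZ.
have d2 := is_derive1_comp (is_derive_expR (a * t)) d1.
have := is_deriveZ c d2; rewrite mulr1 [expR _ * a]mulrC; exact.
Qed.

(** Picard iteration measured against the weight [w t = exp (2 L t)]: an
    [L]-Lipschitz field followed by integration contracts the weighted distance
    by a factor [1 / 2], uniformly in time, so the iterates converge on the
    whole half line at once. *)
Lemma picard_lindelof : exists x : R -> I -> R,
  x 0 = x0 /\ forall (t : R) i, 0 <= t -> is_derive t 1 (x^~ i) (F (x t) i).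
Proof.
have /choice[next nextP] := step.
have c0 i : continuous ((fun (_ : R) i => x0 i) ^~ i) by exact: (@cst_continuous R R (x0 i)).
pose u k := sval (iter k next (exist _ _ c0)).
have uS0 k i : u k.+1 0 i = x0 i by have [+ _] := nextP (iter k next (exist _ _ c0)); apply.
have u0 k i : u k 0 i = x0 i by case: k.
have ud k i (t : R) : is_derive t 1 ((u k.+1)^~ i) (field_along (u k) i t).
  by have [_] := nextP (iter k next (exist _ _ c0)); apply.
have uc k i : continuous ((u k)^~ i) by exact: (svalP (iter k next (exist _ _ c0))).
pose C := (\sum_i `|F x0 i|) / (2 * L).
pose w t := expR (2 * L * t).
have w0 t : 0 <= w t by exact: expR_ge0.
have C0 : 0 <= C by rewrite divr_ge0 ?sumr_ge0// mulr_ge0// ltW.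
have wd c (t : R) : is_derive t 1 (fun s => c * w s) (L * (2 * c * w t)).
  have -> : L * (2 * c * w t) = c * (2 * L * w t) by ring.
  exact: is_derive_cst_expR.
(* Integrating a bound [2 L c w] gains the factor [1 / 2], as [w' = 2 L w]. *)
have compare (f : R -> R) df c : 0 <= c -> f 0 = 0 ->
    (forall t : R, is_derive t 1 f (df t)) ->
    (forall t, 0 <= t -> `|df t| <= L * (2 * c * w t)) ->
    forall t, 0 <= t -> `|f t| <= c * w t.
  move=> cge0 f0 fd fw t t0.
  have := @norm_le_derive _ f (fun s => c * w s) df (fun s => L * (2 * c * w s)) _ _ t0.
  rewrite f0 subr0 => H; apply: le_trans (H _ _ _ _ _) _ => //.
  - by apply: (@derive_continuous_within _ _ df) => s _.
  - by apply: (@derive_continuous_within _ _ (fun s => L * (2 * c * w s))) => s _.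
  - by move=> s /andP[/ltW s0 _]; exact: fw.
  - by rewrite lerBlDr lerDl mulr_ge0.
have close k t i : 0 <= t -> `|u k.+1 t i - u k t i| <= C * w t / 2 ^+ k.
  elim: k t i => [|k IH] t i t0.
    rewrite expr0 divr1.
    apply: (compare (fun t => u 1%N t i - u 0%N t i) (fun s => field_along (u 0%N) i s - 0)) => //.
    - by rewrite !u0 subrr.
    - move=> s; have ? := ud 0%N i s.
      have ? : is_derive s 1 ((u 0%N)^~ i) 0 by exact: (is_derive_cst (x0 i)).
      exact: is_deriveB.
    - move=> s s0; rewrite subr0 /field_along/=.
      have -> : L * (2 * C * w s) = (\sum_i `|F x0 i|) * w s.
        by rewrite /C; field; exact: lt0r_neq0.
      apply: (@le_trans _ _ (\sum_i `|F x0 i|)).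
        rewrite (bigD1 i)//= lerDl sumr_ge0//.
      rewrite ler_peMr ?sumr_ge0//.
      by rewrite -expR0 ler_expR mulr_ge0// mulr_ge0// ltW.
  rewrite -mulrA [w t / _]mulrC mulrA.
  apply: (compare (fun t => u k.+2 t i - u k.+1 t i)
            (fun s => field_along (u k.+1) i s - field_along (u k) i s) _ _ _
            (fun s => is_derive1B (ud k.+1 i s) (ud k i s))) => //.
  - by rewrite divr_ge0// exprn_ge0.
  - by rewrite !u0 subrr.
  - move=> s s0; rewrite /field_along.
    apply: FL => j; rewrite (max_l s0).
    have -> : 2 * (C / 2 ^+ k.+1) * w s = C * w s / 2 ^+ k.
      by rewrite exprS; field; exact: expf_neq0.
    exact: IH.
have /choice[x1 x1P] : forall p : R * I, exists l, 0 <= p.1 ->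
    forall k, `|u k p.1 p.2 - l| <= 2 * (C * w p.1) / 2 ^+ k.
  move=> [t i] /=; have [t0|_] := leP 0 t; last by exists 0.
  by have [l lP] := geometric_cauchy_limit (fun k => close k t i t0); exists l.
pose x t i := x1 (t, i).
have xu t i : 0 <= t -> forall k, `|u k t i - x t i| <= 2 * (C * w t) / 2 ^+ k.
  by move=> t0 k; exact: (x1P (t, i) t0 k).
have small (K e : R) : 0 < e -> exists k : nat, K / 2 ^+ k < e.
  move=> e0; exists (Num.bound `|K / e|).
  rewrite ltr_pdivrMr ?exprn_gt0// mulrC -ltr_pdivrMr//.
  rewrite (le_lt_trans (ler_norm _))// (lt_trans (archi_boundP _))//.
  by rewrite -natrX ltr_nat ltn_expl.
have xc i : continuous (fun t : R => x (Num.max t 0) i).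
  move=> t; apply/cvgrPdist_le => e e0.
  pose K := 2 * (C * w (`|t| + 1)).
  have [k ke] : exists k : nat, K / 2 ^+ k < e / 3 by apply: small; rewrite divr_gt0.
  pose z (s : R) := x (Num.max s 0) i; pose v (s : R) := u k (Num.max s 0) i.
  have H (s : R) : s <= `|t| + 1 -> `|v s - z s| <= e / 3.
    move=> st; apply: le_trans (ltW ke).
    apply: le_trans (xu _ _ _ k) _; first by rewrite le_max lexx orbT.
    rewrite ler_pM2r ?invr_gt0 ?exprn_gt0// ler_pM2l// ler_wpM2l// ler_expR ler_pM2l ?mulr_gt0//.
    by rewrite ge_max st addr_ge0.
  have := @continuous_max0 _ (uc k i) t => /cvgrPdist_le/(_ (e / 3)).
  rewrite divr_gt0// => /(_ isT) Hk.
  near=> s.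
  have h1 : `|v t - v s| <= e / 3 by near: s; exact: Hk.
  have /H h2 : t <= `|t| + 1 by rewrite (le_trans (ler_norm _))// lerDl.
  have /H h3 : s <= `|t| + 1.
    have -> : s = t - (t - s) by ring.
    rewrite (le_trans (ler_norm _))// (le_trans (ler_normB _ _))// lerD2l; apply: ltW.
    by near: s; exists 1 => /=.
  change (`|z t - z s| <= e).
  move: h1 h2 h3; rewrite !ler_norml; lra.
have fc := continuous_field_along xc.
have /choice[G GP] : forall i, exists G : R -> R, G 0 = 0 /\
    forall t : R, is_derive t 1 G (field_along x i t).
  by move=> i; have [G] := primitive_exists (fc i); exists G.
pose y t i := x0 i + G i t.
have yd i (t : R) : is_derive t 1 (y^~ i) (field_along x i t).
  have [_ /(_ t) ?] := GP i.
  rewrite -[X in is_derive _ _ _ X]add0r; exact: is_deriveD.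
have y0 i : y 0 i = x0 i by rewrite /y; have [-> _] := GP i; rewrite addr0.
have xy t i : 0 <= t -> x t i = y t i.
  move=> t0; apply/eqP; rewrite -subr_eq0 -normr_le0; apply/ler_addgt0Pl => e e0; rewrite addr0.
  have [k ke] := small (2 * (C * w t)) (e / 2) ltac:(by rewrite divr_gt0).
  have h1 : `|u k.+1 t i - y t i| <= 2 * (C * w t) / 2 ^+ k.
    have -> : 2 * (C * w t) / 2 ^+ k = 2 * C / 2 ^+ k * w t by ring.
    apply: (compare (fun t => u k.+1 t i - y t i)
            (fun s => field_along (u k) i s - field_along x i s)) => //.
    - by rewrite divr_ge0 ?exprn_ge0// mulr_ge0.
    - by rewrite u0 y0 subrr.
    - move=> s s0; rewrite /field_along; apply: FL => j; rewrite (max_l s0).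
      apply: le_trans (xu _ _ s0 k) _.
      have h : 0 <= 2 * (C * w s) / 2 ^+ k.
        by apply: divr_ge0; [apply: mulr_ge0 => //; exact: mulr_ge0|exact: exprn_ge0].
      have -> : 2 * (2 * C / 2 ^+ k) * w s = 2 * (2 * (C * w s) / 2 ^+ k) by ring.
      lra.
  have h2 := xu t i t0 k.+1.
  have h3 : 2 * (C * w t) / 2 ^+ k.+1 <= 2 * (C * w t) / 2 ^+ k.
    have h : 0 <= 2 * (C * w t) / 2 ^+ k.
      by apply: divr_ge0; [apply: mulr_ge0 => //; exact: mulr_ge0|exact: exprn_ge0].
    have -> : 2 * (C * w t) / 2 ^+ k.+1 = 2 * (C * w t) / 2 ^+ k / 2.
      by rewrite exprS; field; exact: expf_neq0.
    lra.
  move: h1 h2; rewrite !ler_norml; lra.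
exists y; split; first by apply/funext => i; exact: y0.
move=> t i t0; have := yd i t; rewrite /field_along (max_l t0).
by have -> : x t = y t by apply/funext => j; exact: xy.
Unshelve. all: by end_near. Qed.

End Picard.

Section Uniqueness.
Context {R : realType}.

Lemma continuous_sum_seq (T : topologicalType) (J : Type) (r : seq J) (f : J -> T -> R) :
  (forall j, continuous (f j)) -> continuous (fun x => \sum_(j <- r) f j x).
Proof.
move=> fc; elim: r => [|j r IH] x.
  by under eq_fun do rewrite big_nil; exact: cvg_cst.
by under eq_fun do rewrite big_cons; apply: cvgD; [exact: fc|exact: IH].
Qed.

Context (I : finType) (F : (I -> R) -> I -> R) (L : R).
Hypothesis FL : sup_lipschitz L F.

(** Gronwall's argument: the squared distance [w] satisfies [w' <= K w], so
    [w t * exp (- K t)] is nonincreasing, and it starts at 0. *)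
Lemma lipschitz_ode_unique (a b : R -> I -> R) (s t : R) : s <= t ->
  (forall i, {within `[s, t], continuous (a^~ i)}) ->
  (forall i, {within `[s, t], continuous (b^~ i)}) ->
  (forall r i, s < r < t -> is_derive r 1 (a^~ i) (F (a r) i)) ->
  (forall r i, s < r < t -> is_derive r 1 (b^~ i) (F (b r) i)) ->
  a s = b s -> a t = b t.
Proof.
move=> st ac bc ad bd abs.
pose d r i := a r i - b r i.
pose w r := \sum_i d r i * d r i.
pose K := 2 * L * #|I|%:R.
pose dw r := \sum_i ((F (a r) i - F (b r) i) * d r i + d r i * (F (a r) i - F (b r) i)).
have wd r : s < r < t -> is_derive r 1 w (dw r).
  move=> rst; apply: is_derive1_sum => i.
  by apply: is_derive1M; apply: is_derive1B; [exact: ad|exact: bd|exact: ad|exact: bd].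
have sq i r : d r i * d r i <= w r.
  by rewrite /w (bigD1 i)//= lerDl sumr_ge0// => j _; rewrite -expr2 sqr_ge0.
have w0 r : 0 <= w r by apply: sumr_ge0 => j _; rewrite -expr2 sqr_ge0.
have dle i r : `|d r i| <= Num.sqrt (w r).
  by rewrite -sqrtr_sqr ler_sqrt// expr2.
have dwK r : dw r <= K * w r.
  have -> : K * w r = \sum_(i : I) 2 * L * w r.
    by rewrite sumr_const -mulr_natr /K; ring.
  apply: ler_sum => i _.
  have h1 := dle i r.
  have h2 : `|F (a r) i - F (b r) i| <= L * Num.sqrt (w r) by apply: FL => j; exact: dle.
  have h3 := ler_pM (normr_ge0 _) (normr_ge0 _) h1 h2.
  have h4 : Num.sqrt (w r) * (L * Num.sqrt (w r)) = L * w r.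
    by rewrite mulrCA -expr2 sqr_sqrtr.
  rewrite h4 -normrM in h3.
  have := le_trans (ler_norm _) h3; lra.
pose h r := w r * (1 * expR (- K * r)).
have hd r : s < r < t -> is_derive r 1 h (dw r * (1 * expR (- K * r)) + w r * (1 * (- K * expR (- K * r)))).
  by move=> rst; apply: is_derive1M; [exact: wd|exact: is_derive_cst_expR].
have : h t <= h s.
  apply: (nonincreasing_derive st _ hd).
  - have cw : {within `[s, t], continuous w}.
      apply: continuous_sum_seq => i x.
      by apply: cvgM; apply: cvgB; [exact: ac|exact: bc|exact: ac|exact: bc].
    have ce : {within `[s, t], continuous (fun r => 1 * expR (- K * r))}.
      by apply: derive_continuous_within => r _; exact: is_derive_cst_expR.
    by move=> x; apply: cvgM; [exact: cw|exact: ce].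
  - move=> r _.
    have -> : dw r * (1 * expR (- K * r)) + w r * (1 * (- K * expR (- K * r))) =
      (dw r - K * w r) * expR (- K * r) by ring.
    by rewrite mulr_le0_ge0 ?expR_ge0// subr_le0.
have -> : h s = 0.
  by rewrite /h /w big1 ?mul0r// => i _; rewrite /d abs subrr mul0r.
rewrite /h mul1r => ht.
have wt : w t = 0.
  apply/eqP; rewrite eq_le w0 andbT.
  by rewrite -(pmulr_lle0 _ (expR_gt0 (- K * t))).
apply/funext => i; apply/eqP; rewrite -subr_eq0.
have := sq i t; rewrite wt => h1.
have : d t i * d t i = 0 by apply/eqP; rewrite eq_le h1 -expr2 sqr_ge0.
by move/eqP; rewrite mulf_eq0 orbb.
Qed.

End Uniqueness.

(** * Barbalat's lemma *)

Section Barbalat.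
Context {R : realType}.

(** On a window of length [d] the increment of [f] is [d * df c] for some [c],
    and it is small because [f] converges; a Lipschitz [df] cannot differ much
    from [df c] on such a window. *)
Lemma barbalat (f df : R -> R) (l L : R) :
  f t @[t --> +oo] --> l ->
  (forall t : R, 0 <= t -> is_derive t 1 f (df t)) ->
  (forall s t, 0 <= s -> 0 <= t -> `|df s - df t| <= L * `|s - t|) ->
  df t @[t --> +oo] --> 0.
Proof.
move=> fl fd dfL.
have L0 : 0 <= L.
  have := dfL 1 0 ler01 (lexx _); rewrite subr0 normr1 mulr1.
  exact: le_trans.
apply/cvgrPdist_le => e e0.
(* With this window, the Lipschitz bound costs at most [e / 2]. *)
pose d := e / (2 * (L + 1)).
have d0 : 0 < d by rewrite divr_gt0// mulr_gt0// ltr_pwDr.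
have dE : d * (L + 1) = e / 2 by rewrite /d; field; rewrite gt_eqF// ltr_pwDr.
have ed0 : 0 < e * d / 4 by apply: divr_gt0 => //; exact: mulr_gt0.
have /cvgrPdist_le/(_ _ ed0) [A [Areal AP]] := fl.
near=> t.
have t0 : 0 <= t by near: t; exact: nbhs_pinfty_ge.
have tA : A < t by near: t; exact: nbhs_pinfty_gt.
have h1 := AP t tA.
have h2 : `|l - f (t + d)| <= e * d / 4 by apply: AP; rewrite (lt_le_trans tA)// lerDl ltW.
have fd' (x : R) : x \in `]t, t + d[ -> is_derive x 1 f (df x).
  by rewrite in_itv/= => /andP[tx _]; apply: fd; rewrite (le_trans t0)// ltW.
have fc : {within `[t, t + d], continuous f}.
  apply: (@derive_continuous_within _ _ df) => x /andP[tx _]; apply: fd; exact: le_trans tx.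
have [c] := MVT (ltac:(by rewrite ltrDl) : t < t + d) fd' fc.
rewrite in_itv/= => /andP[tc ctd] E.
have h3 : `|df t - df c| <= L * d.
  apply: le_trans (dfL t c t0 _) _; first by rewrite (le_trans t0)// ltW.
  by rewrite ler_wpM2l// ler_norml; lra.
have h4 : `|df c| * d <= e * d / 2.
  have -> : `|df c| * d = `|f (t + d) - f t|.
    by rewrite E normrM (_ : t + d - t = d) ?(gtr0_norm d0)//; ring.
  move: h1 h2; rewrite !ler_norml/=; lra.
have h5 : `|df c| <= e / 2.
  by rewrite -(ler_pM2r d0) mulrAC.
have h6 : L * d <= e / 2 by rewrite -dE; nra.
rewrite sub0r normrN; move: h3 h5; rewrite !ler_norml; lra.
Unshelve. all: by end_near. Qed.

End Barbalat.

(** * Matrix-valued maps *)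

Section MatrixAnalysis.
Context {R : realType}.

Lemma cvg_mxP (T : Type) (F : set_system T) (FF : Filter F) (m n : nat)
    (A : T -> 'M[R]_(m, n)) (B : 'M[R]_(m, n)) :
  A x @[x --> F] --> B <-> forall i j, A x i j @[x --> F] --> B i j.
Proof.
split=> [AB i j|AB].
  by apply: (@cvg_comp _ _ _ A (fun M : 'M[R]_(m, n) => M i j) _ (nbhs B)) => //; exact: coord_continuous.
apply/cvgrPdist_le => e e0.
have H : \forall x \near F, forall ij : 'I_m * 'I_n, `|B ij.1 ij.2 - A x ij.1 ij.2| <= e.
  apply: (@filter_forall T ('I_m * 'I_n)%type (fun ij x => `|B ij.1 ij.2 - A x ij.1 ij.2| <= e) F) => -[i j] /=.
  by have /cvgrPdist_le := AB i j; apply.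
apply: filterS H => x Hx.
rewrite [leLHS]/Num.Def.normr/= mx_normrE (bigmax_le _ (ltW e0))//= => -[i j] _.
by rewrite !mxE; exact: (Hx (i, j)).
Qed.

Lemma continuous_mx (T : topologicalType) (m n : nat) (f : T -> 'M[R]_(m, n)) (x : T) :
  (forall i j, {for x, continuous (fun y => f y i j)}) -> {for x, continuous f}.
Proof.
by move=> fc; apply: (@cvg_mxP T (nbhs x) _ m n f (f x)).2 => i j; exact: fc.
Qed.

Lemma is_derive_mxP (m n : nat) (A : R -> 'M[R]_(m, n)) (B : 'M[R]_(m, n)) (t : R) :
  is_derive t 1 A B <-> forall i j, is_derive t 1 (fun s => A s i j) (B i j).
Proof.
split=> [[dA AB] i j|dAB].
  split; first by move/derivable_mxP : dA; apply.
  by rewrite -AB derive_mx// mxE.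
have dA : derivable A t 1 by apply/derivable_mxP => i j; have [] := dAB i j.
split=> //; rewrite derive_mx//; apply/matrixP => i j; rewrite mxE.
by have [] := dAB i j.
Qed.

Lemma compact_box n (r : R) : compact [set x : 'cV[R]_n | forall i, `|x i 0| <= r].
Proof.
have -> : [set x : 'cV[R]_n | forall i, `|x i 0| <= r] =
    trmx @` [set v : 'rV[R]_n | forall i, `[- r, r]%classic (v ord0 i)].
  apply/seteqP; split=> [x xr|_ [v vr <-] i].
    exists x^T; last by rewrite trmxK.
    by move=> i; rewrite /= mxE in_itv/= -ler_norml; exact: xr.
  by have := vr i; rewrite mxE/= in_itv/= ler_norml.
apply: continuous_compact; last first.
  by apply: (@rV_compact R n (fun=> `[- r, r]%classic)) => i; exact: segment_compact.
apply: continuous_subspaceT => v.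
apply: continuous_mx => i j.
have -> : (fun u : 'rV[R]_n => u^T i j) = (fun u => u j i).
  by apply/funext => u; rewrite mxE.
exact: coord_continuous.
Qed.

Lemma continuous_box_bounded n (r : R) (f : 'cV[R]_n -> R) :
  (forall x : 'cV[R]_n, (forall i, `|x i 0| <= r) -> {for x, continuous f}) ->
  exists K, forall x : 'cV[R]_n, (forall i, `|x i 0| <= r) -> `|f x| <= K.
Proof.
move=> fc.
have fc' : {within [set x : 'cV[R]_n | forall i, `|x i 0| <= r], continuous f}.
  by apply: continuous_in_subspaceT => x /set_mem xr; exact: fc.
have [K [_ KP]] := compact_bounded (continuous_compact fc' (@compact_box n r)).
exists (K + 1) => x xr; apply: (KP (K + 1)); first by rewrite ltrDl.
by exists x.
Qed.

(** The mean value theorem along the segment from [y] to [x], which stays in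
    the convex box; the partial derivatives are bounded there by compactness. *)
Lemma continuously_differentiable_lipschitz n m p (g : 'cV[R]_n -> 'M[R]_(m, p)) (r : R) i j :
  continuously_differentiable g ->
  exists2 K, 0 <= K & forall x y : 'cV[R]_n, (forall k, `|x k 0| <= r) -> (forall k, `|y k 0| <= r) ->
    forall M, 0 <= M -> (forall k, `|x k 0 - y k 0| <= M) -> `|g x i j - g y i j| <= K * M.
Proof.
move=> [gd gc].
pose c k (x : 'cV[R]_n) : R := ('d g x (delta_mx k 0 : 'cV[R]_n)) i j.
have /choice[K KP] : forall k, exists K, forall x : 'cV[R]_n, (forall i, `|x i 0| <= r) -> `|c k x| <= K.
  move=> k; apply: continuous_box_bounded => x _.
  apply: (@continuous_comp _ _ _ (fun x => 'd g x (delta_mx k 0 : 'cV[R]_n))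
    (fun M : 'M[R]_(m, p) => M i j)); [exact: gc|exact: coord_continuous].
exists (\sum_k `|K k|); first exact: sumr_ge0.
move=> x y xr yr M M0 xyM.
pose v := x - y.
pose P (t : R) := y + t *: v.
have Pr t : 0 <= t <= 1 -> forall k, `|P t k 0| <= r.
  move=> /andP[t0 t1] k; rewrite /P /v !mxE.
  have -> : y k 0 + t * (x k 0 - y k 0) = t * x k 0 + (1 - t) * y k 0 by ring.
  have := xr k; have := yr k; rewrite !ler_norml => /andP[? ?] /andP[? ?].
  apply/andP; split; nra.
have Pd (t : R) : is_derive t 1 (fun s => g (P s) i j) (\sum_k v k 0 * c k (P t)).
  have -> : \sum_k v k 0 * c k (P t) = ('d g (P t) v) i j.
    have {2}-> : v = \sum_k v k 0 *: (delta_mx k 0 : 'cV[R]_n).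
      by rewrite {1}[v]matrix_sum_delta; apply: eq_bigr => k _; rewrite big_ord1.
    rewrite linear_sum summxE; apply: eq_bigr => k _.
    by rewrite linearZ/= [RHS]mxE.
  apply: (@is_derive_mxP _ _ (fun s => g (P s)) _ t).1.
  have E : (fun h : R => h^-1 *: ((fun s => g (P s)) (h *: (1 : R) + t) - g (P t))) =
           (fun h : R => h^-1 *: (g (h *: v + P t) - g (P t))).
    apply/funext => h; congr (_ *: (g _ - _)).
    by rewrite /P scalerDl addrCA; congr (_ + (_ + _)); rewrite -scalerA scale1r.
  have dv : derivable g (P t) v by exact/diff_derivable/gd.
  split; first by rewrite /derivable; move: dv; rewrite /derivable -E.
  by rewrite -(deriveE _ (gd (P t))) /derive -E.
have P0 : P 0 = y by rewrite /P scale0r addr0.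
have P1 : P 1 = x by rewrite /P scale1r /v addrC subrK.
have fd' (t : R) : t \in `]0, 1[ -> is_derive t 1 (fun s => g (P s) i j) (\sum_k v k 0 * c k (P t)).
  by move=> _; exact: Pd.
have fc' : {within `[0, 1], continuous (fun s => g (P s) i j)}.
  by apply: derive_continuous_within => t _; exact: Pd.
have [t] := MVT ltr01 fd' fc'.
rewrite in_itv/= P0 P1 subr0 mulr1 => /andP[/ltW t0 /ltW t1] ->.
rewrite (le_trans (ler_norm_sum _ _ _))// mulr_suml ler_sum// => k _.
rewrite normrM mulrC ler_pM//; last by have := xyM k; rewrite /v !mxE.
rewrite (le_trans _ (ler_norm _))//; apply: KP; apply: Pr; exact/andP.
Qed.

End MatrixAnalysis.

(** * Sigmoids and their inverses *)

Definition locally_lipschitz {R : realType} (f : R -> R) :=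
  forall r : R, exists2 K, 0 <= K &
    forall x y : R, `|x| <= r -> `|y| <= r -> `|f x - f y| <= K * `|x - y|.

Lemma derive_locally_lipschitz {R : realType} (f df : R -> R) :
  (forall x : R, is_derive x 1 f (df x)) -> continuous df -> locally_lipschitz f.
Proof.
move=> fd dfc r.
have dfc' : {within `[- r, r], continuous df} by exact: continuous_subspaceT.
have [K [_ KP]] := compact_bounded (continuous_compact dfc' (@segment_compact R (- r) r)).
exists (`|K| + 1); first by rewrite addr_ge0.
move=> x y; wlog xy : x y / x <= y => [H xr yr|xr yr].
  have [xy|/ltW yx] := leP x y; first exact: H.
  by rewrite distrC [`|x - y|]distrC; exact: H.
have fd' (z : R) : z \in `]x, y[ -> is_derive z 1 f (df z) by move=> _; exact: fd.
have fc : {within `[x, y], continuous f} by apply: derive_continuous_within => z _; exact: fd.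
have [c /[!in_itv]/= /andP[xc cy] E] := MVT_segment xy fd' fc.
rewrite distrC E normrM [`|x - y|]distrC ler_wpM2r//.
apply: (KP (`|K| + 1)); first by rewrite (le_lt_trans (ler_norm _))// ltrDl.
exists c => //=; rewrite in_itv/=.
by move: xr yr; rewrite !ler_norml; lra.
Qed.

Section Sigmoid.
Context {R : realType} (s : R -> R) (hs : strictly_increasing_sigmoid s).
Notation ds := (s^`())%classic.

Lemma sigmoid_derive (x : R) : is_derive x 1 s (ds x).
Proof.
have [[_ /(_ 0%N x) sd _ _ _] _] := hs.
by split; [exact: sd|rewrite derive1E].
Qed.

Lemma sigmoid_derive_gt0 (x : R) : 0 < ds x.
Proof. by have [_] := hs; apply. Qed.

Lemma sigmoid_derive2 (x : R) : is_derive x 1 ds ((s^`(2))%classic x).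
Proof.
have [[_ /(_ 1%N x) sd _ _ _] _] := hs.
split; first exact: sd.
by rewrite -[LHS]/(('D_1 (s^`(1))%classic x)) -derive1E.
Qed.

Lemma sigmoid_derive2_continuous : continuous (s^`(2))%classic.
Proof.
move=> x; have [[_ /(_ 2%N x) sd _ _ _] _] := hs.
exact/differentiable_continuous/derivable1_diffP.
Qed.

Lemma sigmoid_continuous : continuous s.
Proof. by move=> x; exact: is_derive_continuous (sigmoid_derive x). Qed.

Lemma sigmoid_derive_continuous : continuous ds.
Proof. by move=> x; exact: is_derive_continuous (sigmoid_derive2 x). Qed.

Lemma sigmoidN (x : R) : s (- x) = - s x.
Proof. by have [[_ _ + _ _] _] := hs; apply. Qed.

Lemma sigmoid0 : s 0 = 0.
Proof. by have := sigmoidN 0; rewrite oppr0 => h; lra. Qed.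

Lemma sigmoid_norm_lt1 (x : R) : `|s x| < 1.
Proof. by have [[+ _ _ _ _] _] := hs => /(_ x); rewrite ltr_norml. Qed.

Lemma sigmoid_lt (x y : R) : x < y -> s x < s y.
Proof.
move=> xy.
have fd' (z : R) : z \in `]x, y[ -> is_derive z 1 s (ds z) by move=> _; exact: sigmoid_derive.
have [c _ E] := MVT xy fd' (continuous_subspaceT sigmoid_continuous).
by rewrite -subr_gt0 E mulr_gt0 ?sigmoid_derive_gt0// subr_gt0.
Qed.

Lemma sigmoid_inj : injective s.
Proof.
move=> x y sxy; apply/eqP; rewrite eq_le !leNgt.
by apply/andP; split; apply/negP => /sigmoid_lt; rewrite sxy ltxx.
Qed.

Lemma sigmoid_surj (y : R) : `|y| < 1 -> exists x, s x = y.
Proof.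
move=> y1.
have [[_ _ _ s1 _] _] := hs.
have [x xs] : exists x : R, `|y| < s x.
  have /cvgrPdist_lt/(_ (1 - `|y|)) := s1; rewrite subr_gt0 => /(_ y1) [A [_ AP]].
  exists (A + 1); have := AP (A + 1) (ltac:(by rewrite /= ltrDl)).
  by rewrite ltr_norml => /andP[? ?]; lra.
have x0 : 0 <= x.
  rewrite leNgt; apply/negP => /sigmoid_lt; rewrite sigmoid0 => h.
  by have := lt_trans xs h; rewrite normr_lt0.
have [c _ <-] : exists2 c, c \in `[- x, x] & s c = y.
  apply: IVT; first lra.
    exact: continuous_subspaceT sigmoid_continuous.
  move: xs; rewrite sigmoidN ltr_norml => /andP[h1 h2].
  by rewrite ge_min le_max (ltW h1) (ltW h2) orbT.
by exists c.
Qed.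

Lemma sigmoidK : cancel s (Defs.eta s).
Proof.
have inj : {in [set: R] &, injective s} by move=> x y _ _; exact: sigmoid_inj.
by move=> x; exact: (pinvKV (fun=> 0) inj (mem_set (I : [set: R] x))).
Qed.

Lemma etaK (y : R) : `|y| < 1 -> s (Defs.eta s y) = y.
Proof. by move=> /sigmoid_surj[x <-]; rewrite sigmoidK. Qed.

Lemma eta_derive (y : R) : `|y| < 1 -> is_derive y 1 (Defs.eta s) (ds (Defs.eta s y))^-1.
Proof.
move=> y1; rewrite -{1}(etaK y1); apply: is_derive_inverse.
- by near=> z; exact: sigmoidK.
- by near=> z; exact: sigmoid_continuous.
- exact: sigmoid_derive.
- by rewrite gt_eqF// sigmoid_derive_gt0.
Unshelve. all: by end_near. Qed.

Lemma eta0 : Defs.eta s 0 = 0.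
Proof. by rewrite -sigmoid0 sigmoidK sigmoid0. Qed.

Lemma eta_continuous (y : R) : `|y| < 1 -> {for y, continuous (Defs.eta s)}.
Proof. by move=> /eta_derive; exact: is_derive_continuous. Qed.

Lemma sigmoid_locally_lipschitz : locally_lipschitz s.
Proof. exact: derive_locally_lipschitz sigmoid_derive sigmoid_derive_continuous. Qed.

Lemma inv_sigmoid_derive_locally_lipschitz : locally_lipschitz (fun x => (ds x)^-1).
Proof.
have n0 x : ds x != 0 by rewrite gt_eqF// sigmoid_derive_gt0.
move: (ds) n0 sigmoid_derive_continuous (s^`(2))%classic sigmoid_derive2
  sigmoid_derive2_continuous => f f0 fc ddf fd ddfc.
apply: (derive_locally_lipschitz (fun x => is_deriveV (f0 x) (fd x))).
move=> x; apply: cvgZ; last exact: ddfc.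
apply: cvgN; apply: cvgV; first by rewrite expf_neq0.
by apply: cvgM; exact: fc.
Qed.

End Sigmoid.

(** * Bounded Lipschitz functions and truncation *)

Section LipschitzOn.
Context {R : realType} (I : finType) (B : set (I -> R)).
Implicit Types (h k : (I -> R) -> R).

(** Boundedness is part of the notion because it is what makes products, and
    compositions with locally Lipschitz maps, Lipschitz again. *)
Definition lipschitz_bounded h := exists K, [/\ 0 <= K,
  forall x, B x -> `|h x| <= K &
  forall x y, B x -> B y -> forall M, 0 <= M -> (forall i, `|x i - y i| <= M) ->
    `|h x - h y| <= K * M].

Lemma lipschitz_bounded_intro h (K1 K2 : R) : (forall x, B x -> `|h x| <= K1) ->
  (forall x y, B x -> B y -> forall M, 0 <= M -> (forall i, `|x i - y i| <= M) ->
    `|h x - h y| <= K2 * M) -> lipschitz_bounded h.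
Proof.
move=> h1 h2; exists (`|K1| + `|K2|); split; first by rewrite addr_ge0.
  move=> x /h1 /le_trans; apply.
  by rewrite (le_trans (ler_norm _))// lerDl.
move=> x y Bx By M M0 xyM; apply: le_trans (h2 _ _ Bx By _ M0 xyM) _.
by rewrite ler_wpM2r// (le_trans (ler_norm _))// lerDr.
Qed.

Lemma eq_lipschitz_bounded h k : h =1 k -> lipschitz_bounded k -> lipschitz_bounded h.
Proof. by move=> /funext ->. Qed.

Lemma lipschitz_bounded_cst (c : R) : lipschitz_bounded (fun=> c).
Proof.
apply: (@lipschitz_bounded_intro _ `|c| 0) => // x y _ _ M _ _.
by rewrite subrr normr0 mul0r.
Qed.

Lemma lipschitz_boundedD h k :
  lipschitz_bounded h -> lipschitz_bounded k -> lipschitz_bounded (fun x => h x + k x).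
Proof.
move=> [H [H0 hb hL]] [K [K0 kb kL]]; exists (H + K); split; first exact: addr_ge0.
  by move=> x Bx; rewrite (le_trans (ler_normD _ _))// lerD// ?hb ?kb.
move=> x y Bx By M M0 xyM.
have -> : h x + k x - (h y + k y) = (h x - h y) + (k x - k y) by ring.
by rewrite mulrDl (le_trans (ler_normD _ _))// lerD// ?hL ?kL.
Qed.

Lemma lipschitz_boundedM h k :
  lipschitz_bounded h -> lipschitz_bounded k -> lipschitz_bounded (fun x => h x * k x).
Proof.
move=> [H [H0 hb hL]] [K [K0 kb kL]].
apply: (@lipschitz_bounded_intro _ (H * K) (2 * H * K)).
  by move=> x Bx; rewrite normrM ler_pM// ?hb ?kb.
move=> x y Bx By M M0 xyM.
have -> : h x * k x - h y * k y = h x * (k x - k y) + (h x - h y) * k y by ring.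
have -> : 2 * H * K * M = H * (K * M) + H * M * K by ring.
by rewrite (le_trans (ler_normD _ _))// !normrM lerD// ler_pM// ?hb ?kb ?hL ?kL.
Qed.

Lemma lipschitz_bounded_sum (J : Type) (r : seq J) (h : J -> (I -> R) -> R) :
  (forall j, lipschitz_bounded (h j)) -> lipschitz_bounded (fun x => \sum_(j <- r) h j x).
Proof.
move=> hl; elim: r => [|j r IH].
  by under eq_fun do rewrite big_nil; exact: lipschitz_bounded_cst.
by under eq_fun do rewrite big_cons; exact: lipschitz_boundedD.
Qed.

Lemma lipschitz_boundedN h : lipschitz_bounded h -> lipschitz_bounded (fun x => - h x).
Proof.
move=> hl; have := lipschitz_boundedM (lipschitz_bounded_cst (- 1)) hl.
by under eq_fun do rewrite mulN1r.
Qed.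

Lemma lipschitz_bounded_comp (f : R -> R) h : locally_lipschitz f ->
  lipschitz_bounded h -> lipschitz_bounded (fun x => f (h x)).
Proof.
move=> fl [H [H0 hb hL]]; have [K K0 KP] := fl H.
apply: (@lipschitz_bounded_intro _ (`|f 0| + K * H) (K * H)).
  move=> x Bx.
  have -> : f (h x) = f 0 + (f (h x) - f 0) by ring.
  rewrite (le_trans (ler_normD _ _))// lerD2l (le_trans (KP _ _ _ _))// ?hb// ?normr0//.
  by rewrite subr0 ler_wpM2l// hb.
move=> x y Bx By M M0 xyM.
rewrite (le_trans (KP _ _ _ _))// ?hb// -mulrA ler_wpM2l//; exact: hL.
Qed.

Lemma lipschitz_bounded_comp_cV n m p (g : 'cV[R]_n -> 'M[R]_(m, p)) (h : 'I_n -> (I -> R) -> R)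
    (i : 'I_m) (j : 'I_p) :
  continuously_differentiable g -> (forall l, lipschitz_bounded (h l)) ->
  lipschitz_bounded (fun x => g (\col_l h l x) i j).
Proof.
move=> gC1 /choice[H HP].
pose r := \sum_k H k.
have H0 (k : 'I_n) : 0 <= H k by have [] := HP k.
have Hr (k : 'I_n) : H k <= r by rewrite /r (bigD1 k)//= lerDl sumr_ge0.
have r0 : 0 <= r by exact: sumr_ge0.
have hb x : B x -> forall k : 'I_n, `|(\col_l h l x) k 0| <= r.
  by move=> Bx k; rewrite mxE; apply: le_trans (Hr k); have [_ hb _] := HP k; exact: hb.
have [K K0 KP] := @continuously_differentiable_lipschitz R n m p g r i j gC1.
apply: (@lipschitz_bounded_intro _ (`|g 0 i j| + K * r) (K * r)).
  move=> x Bx; set v := \col_k _.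
  have -> : g v i j = g 0 i j + (g v i j - g 0 i j) by ring.
  rewrite (le_trans (ler_normD _ _))// lerD2l KP//; first exact: hb.
    by move=> k; rewrite mxE normr0.
  by move=> k; rewrite [X in _ - X]mxE subr0; exact: hb.
move=> x y Bx By M M0 xyM.
rewrite -mulrA; apply: KP; [exact: hb|exact: hb|exact: mulr_ge0|move=> k].
rewrite !mxE; have [_ _ hL] := HP k.
by rewrite (le_trans (hL _ _ Bx By M M0 xyM))// ler_wpM2r.
Qed.

End LipschitzOn.

Lemma lipschitz_bounded_coord {R : realType} (I : finType) (r : R) (i : I) :
  lipschitz_bounded [set x : I -> R | forall j, `|x j| <= r] (fun x => x i).
Proof.
apply: (@lipschitz_bounded_intro _ _ _ _ r 1) => [x|x y _ _ M _]; first exact.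
by rewrite mul1r; exact.
Qed.

Definition clip {R : realType} (r x : R) : R := Num.max (- r) (Num.min r x).

Section Clip.
Context {R : realType} (r : R) (r0 : 0 <= r).

Lemma clip_norm (x : R) : `|clip r x| <= r.
Proof.
rewrite /clip ler_norml le_max lexx ge_max ge_min lexx !andbT /=.
by move: r0; lra.
Qed.

Lemma clip_id (x : R) : `|x| <= r -> clip r x = x.
Proof. by rewrite ler_norml /clip => /andP[xr rx]; rewrite min_r// max_r. Qed.

Lemma clip_lipschitz (x y : R) : `|clip r x - clip r y| <= `|x - y|.
Proof.
have h1 := ler_norm (x - y); have h2 := ler_norm (y - x).
rewrite (distrC y x) in h2; rewrite /clip !maxEle !minEle.
case: (leP r x) => ?; case: (leP r y) => ?; case: (leP (- r) r) => ?;
  case: (leP (- r) x) => ?; case: (leP (- r) y) => ?; rewrite ler_norml; lra.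
Qed.

(** A field that is Lipschitz on the box of radius [r] becomes globally
    Lipschitz when its argument is clipped to that box. *)
Lemma sup_lipschitz_clip (I : finType) (F : (I -> R) -> I -> R) :
  (forall i, lipschitz_bounded [set x : I -> R | forall j, `|x j| <= r] (F^~ i)) ->
  exists2 L, 0 < L & sup_lipschitz L (fun x => F (fun i => clip r (x i))).
Proof.
move=> /choice[K KP].
have K0 i : 0 <= K i by have [] := KP i.
exists (1 + \sum_i K i); first by rewrite ltr_pwDl// sumr_ge0.
move=> x y M xyM i; have [_ _ L] := KP i.
have M0 : 0 <= M by exact: le_trans (xyM i).
apply: le_trans (L _ _ _ _ M M0 _) _.
- by move=> j; exact: clip_norm.
- by move=> j; exact: clip_norm.
- by move=> j; apply: le_trans (clip_lipschitz _ _) _.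
- rewrite ler_wpM2r// (bigD1 i)//= addrCA lerDl addr_ge0// sumr_ge0//.
Qed.

End Clip.

(** * The closed loop in lifted error coordinates *)

Section Coordinates.
Context {R : realType} (n : nat).

Lemma is_derive_coord (f : R -> R) (df : R) (p v : 'cV[R]_n) i :
  is_derive (p i 0) 1 f df ->
  is_derive p v (fun y : 'cV[R]_n => f (y i 0)) (df * v i 0).
Proof.
move=> fd.
pose g (t : R) := v i 0 * t + p i 0.
have gd : is_derive (0 : R) 1 g (v i 0 * 1 + 0).
  exact: (is_derive1D (is_derive1Z _ (is_derive_id _ _)) (is_derive_cst _ _ _)).
have g0 : g 0 = p i 0 by rewrite /g mulr0 add0r.
rewrite -g0 in fd.
have := is_derive1_comp fd gd; rewrite addr0 mulr1 => fgd.
have E : (fun h : R => h^-1 *: ((f \o g) (h *: (1 : R) + 0) - (f \o g) 0)) =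
         (fun h : R => h^-1 *: ((fun y : 'cV[R]_n => f (y i 0)) (h *: v + p) - f (p i 0))).
  apply/funext => h; congr (_ *: _); rewrite /= g0; congr (f _ - _).
  by rewrite !mxE /g addr0 /= [_ *: _]mulr1 mulrC.
have [d1 d2] := fgd.
split; first by move: d1; rewrite /derivable E.
by move: d2; rewrite /derive E.
Qed.

Lemma D_mul (q x : 'cV[R]_n) i : (D q *m x) i 0 = q i 0 * x i 0.
Proof. by rewrite /D mul_diag_mx !mxE. Qed.

Lemma DI_mul (q x : 'cV[R]_n) i : (DI q *m x) i 0 = x i 0 / q i 0.
Proof. by rewrite /DI mul_diag_mx !mxE mulrC. Qed.

Variable sigma : 'I_n -> R -> R.
Hypothesis hsigma : forall i, strictly_increasing_sigmoid (sigma i).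

Lemma liftedE (q x : 'cV[R]_n) i :
  lifted sigma q x i 0 = q i 0 * Defs.eta (sigma i) (x i 0 / q i 0).
Proof. by rewrite /lifted D_mul mxE DI_mul. Qed.

Lemma Jac_phi_psi (z : 'cV[R]_n) :
  Jac (Defs.phi sigma) (Defs.psi sigma z) = diag_mx (\row_i ((sigma i)^`()%classic (z i 0))^-1).
Proof.
apply/matrixP => i j; rewrite !mxE.
have -> : (fun y : 'cV[R]_n => Defs.phi sigma y i 0) =
          (fun y => Defs.eta (sigma i) (y i 0)).
  by apply/funext => y; rewrite mxE.
have pE : Defs.psi sigma z i 0 = sigma i (z i 0) by rewrite mxE.
have := eta_derive (hsigma i) (sigmoid_norm_lt1 (hsigma i) (z i 0)).
rewrite sigmoidK// -pE => /(is_derive_coord (delta_mx j 0)) /@derive_val ->.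
by rewrite mxE eqxx andbT mulr_natr.
Qed.

End Coordinates.

Section ClosedLoopField.
Context {R : realType} (n : nat) (sigma : 'I_n -> R -> R).
Context (g1 : 'cV[R]_n -> 'M[R]_n) (f2 : 'cV[R]_n * 'cV[R]_n -> 'cV[R]_n).
Context (g2 : 'cV[R]_n * 'cV[R]_n -> 'M[R]_n) (xb1 xb2 x1d : 'cV[R]_n) (k1 k2 : R).
Hypothesis hsigma : forall i, strictly_increasing_sigmoid (sigma i).
Hypothesis hxb1 : forall i, 0 < xb1 i 0.
Hypothesis hxb2 : forall i, 0 < xb2 i 0.
Hypothesis hk1 : 0 < k1.
Hypothesis hk2 : k2 = k1^-1.
Hypothesis hns : forall x1 x2 : 'cV[R]_n, safe xb1 xb2 (x1, x2) ->
       g1 x1 \in unitmx /\ g2 (x1, x2) \in unitmx.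

(** The components indexed by [inl] are those of [e = z1 - z1d], the ones
    indexed by [inr] are those of [zeta2]. *)
Definition state := ('I_n + 'I_n -> R)%type.
Implicit Types s : state.

Notation ds i := ((sigma i)^`()%classic).
Let zd := lifted sigma xb1 x1d.

Definition zeta s (i : 'I_n) : R := (s (inl i) + zd i 0) / xb1 i 0.
Definition position s : 'cV[R]_n := \col_i (xb1 i 0 * sigma i (zeta s i)).
Definition velocity s : 'cV[R]_n := \col_i (xb2 i 0 * sigma i (s (inr i))).
Definition error s : 'cV[R]_n := \col_i s (inl i).
(** The matrix [Phi zeta1], with the Jacobian of [phi] written out; [drift] is
    [Phi zeta1 *m psi zeta2], and [field] is the right-hand side of the closed
    loop in the coordinates [(e, zeta2)]. *)
Definition gain s : 'M[R]_n :=
  \matrix_(i, j) ((ds i (zeta s i))^-1 * g1 (position s) i j * xb2 j 0).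
Definition drift s : 'cV[R]_n := gain s *m \col_i sigma i (s (inr i)).
Definition field s (k : 'I_n + 'I_n) : R :=
  match k with
  | inl i => drift s i 0
  | inr i => - ((gain s)^T *m (error s + k2 *: drift s)) i 0
  end.

Lemma eq_position s s' : (forall i, s (inl i) = s' (inl i)) -> position s = position s'.
Proof. by move=> ss'; apply/colP => i; rewrite !mxE /zeta ss'. Qed.

Lemma gainE s i j :
  gain s i j = (ds i (zeta s i))^-1 * g1 (position s) i j * xb2 j 0.
Proof. by rewrite mxE. Qed.

Lemma driftE s i : drift s i 0 = \sum_j gain s i j * sigma j (s (inr j)).
Proof. by rewrite mxE; apply: eq_bigr => j _; rewrite [X in _ * X]mxE. Qed.

Lemma field_inrE s i :
  field s (inr i) = - \sum_j gain s j i * (s (inl j) + k2 * drift s j 0).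
Proof.
rewrite /field mxE; congr (- _); apply: eq_bigr => j _.
by rewrite [X in X * _]mxE; congr (_ * _); rewrite [LHS]mxE [X in X + _]mxE [X in _ + X]mxE.
Qed.

Definition state_of (x1 x2 : 'cV[R]_n) : state := fun k =>
  match k with
  | inl i => xb1 i 0 * Defs.eta (sigma i) (x1 i 0 / xb1 i 0) - zd i 0
  | inr i => Defs.eta (sigma i) (x2 i 0 / xb2 i 0)
  end.

Lemma mul_div_cancel (q y : R) : 0 < q -> q * y / q = y.
Proof. by move=> q0; rewrite mulrAC divff ?mul1r// gt_eqF. Qed.

Lemma ratio_lt1 (q x : R) : 0 < q -> `|x| < q -> `|x / q| < 1.
Proof. by move=> q0 xq; rewrite normrM normfV (gtr0_norm q0) ltr_pdivrMr// mul1r. Qed.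

Lemma safe_state s : safe xb1 xb2 (position s, velocity s).
Proof.
by split=> i /=; rewrite mxE normrM gtr0_norm// gtr_pMr// sigmoid_norm_lt1.
Qed.

Lemma zeta_state_of x1 x2 i :
  zeta (state_of x1 x2) i = Defs.eta (sigma i) (x1 i 0 / xb1 i 0).
Proof. by rewrite /zeta /state_of subrK mul_div_cancel. Qed.

Lemma position_state_of x1 x2 : safe xb1 xb2 (x1, x2) -> position (state_of x1 x2) = x1.
Proof.
move=> [h1 _]; apply/colP => i; rewrite mxE zeta_state_of etaK//.
  by rewrite mulrC divfK// gt_eqF.
exact: ratio_lt1.
Qed.

Lemma velocity_state_of x1 x2 : safe xb1 xb2 (x1, x2) -> velocity (state_of x1 x2) = x2.
Proof.
move=> [_ h2]; apply/colP => i; rewrite mxE /= etaK//.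
  by rewrite mulrC divfK// gt_eqF.
exact: ratio_lt1.
Qed.

Lemma state_of_state s : state_of (position s) (velocity s) = s.
Proof.
apply/funext => -[i|i] /=; rewrite mxE mul_div_cancel// sigmoidK//.
by rewrite /zeta mulrC divfK ?gt_eqF// addrK.
Qed.

Lemma lifted_position s i : lifted sigma xb1 (position s) i 0 = s (inl i) + zd i 0.
Proof. by rewrite liftedE mxE mul_div_cancel// sigmoidK// mulrC divfK// gt_eqF. Qed.

Lemma lifted_velocity s i : lifted sigma xb2 (velocity s) i 0 = xb2 i 0 * s (inr i).
Proof. by rewrite liftedE mxE mul_div_cancel// sigmoidK// mulrC. Qed.

Lemma psi_zeta1 s :
  D xb1 *m Defs.psi sigma (DI xb1 *m lifted sigma xb1 (position s)) = position s.
Proof. by apply/colP => i; rewrite D_mul mxE DI_mul lifted_position [RHS]mxE. Qed.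

Lemma psi_zeta2 s :
  Defs.psi sigma (DI xb2 *m lifted sigma xb2 (velocity s)) = \col_i sigma i (s (inr i)).
Proof.
by apply/colP => i; rewrite [LHS]mxE DI_mul lifted_velocity mul_div_cancel// [RHS]mxE.
Qed.

Lemma psi_zeta2' s :
  D xb2 *m Defs.psi sigma (DI xb2 *m lifted sigma xb2 (velocity s)) = velocity s.
Proof. by rewrite psi_zeta2; apply/colP => i; rewrite D_mul !mxE. Qed.

Lemma Phi_gain s : Phi sigma g1 xb1 xb2 (DI xb1 *m lifted sigma xb1 (position s)) = gain s.
Proof.
rewrite /Phi Jac_phi_psi// psi_zeta1 /D.
have -> : \row_i (ds i ((DI xb1 *m lifted sigma xb1 (position s)) i 0))^-1 =
    \row_i (ds i (zeta s i))^-1.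
  by apply/rowP => i; rewrite [LHS]mxE [RHS]mxE DI_mul lifted_position.
by rewrite mul_mx_diag mul_diag_mx; apply/matrixP => i j; rewrite !mxE.
Qed.

Lemma position_field s i :
  (g1 (position s) *m velocity s) i 0 = ds i (zeta s i) * field s (inl i).
Proof.
rewrite /field /drift !mxE mulr_sumr; apply: eq_bigr => j _; rewrite !mxE.
have := sigmoid_derive_gt0 (hsigma i) (zeta s i) => /lt0r_neq0 d0.
by field.
Qed.

(** The control cancels [f2] and inverts [G2]; what remains of [x2'] is the
    Jacobian of the change of coordinates applied to [field].  This is where
    [k2 = 1 / k1] enters: [k2 e2 = k2 A v + e]. *)
Lemma velocity_field s i :
  let x := (position s, velocity s) in
  (f2 x + g2 x *m control sigma g1 f2 g2 xb1 xb2 k1 k2 x1d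
     (lifted sigma xb1 x.1) (lifted sigma xb2 x.2)) i 0 =
  xb2 i 0 * (ds i (s (inr i)) * field s (inr i)).
Proof.
move=> x.
have [_ g2u] := hns (safe_state s).
have d0 j : ds j (s (inr j)) != 0 by rewrite gt_eqF// sigmoid_derive_gt0.
pose J := diag_mx (\row_j (ds j (s (inr j)))^-1).
have JE : Jac (Defs.phi sigma) (Defs.psi sigma (DI xb2 *m lifted sigma xb2 (velocity s))) = J.
  rewrite (Jac_phi_psi hsigma); congr diag_mx; apply/rowP => j.
  by rewrite [LHS]mxE [RHS]mxE DI_mul lifted_velocity mul_div_cancel.
have Ju : J \in unitmx.
  rewrite unitmxE det_diag unitfE; apply/prodf_neq0 => j _.
  by rewrite mxE invr_eq0.
have eE : lifted sigma xb1 (position s) - lifted sigma xb1 x1d = error s.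
  by apply/colP => j; rewrite mxE lifted_position !mxE addrK.
rewrite /control /G2 /F2 /= JE psi_zeta1 psi_zeta2' psi_zeta2 Phi_gain eE -/x -/(drift s).
set w := k2 *: _.
have -> : f2 x + g2 x *m (- (invmx (J *m g2 x) *m (J *m f2 x + w))) = - (invmx J *m w).
  have E : g2 x *m invmx (J *m g2 x) = invmx J.
    apply: (can_inj (mulKmx Ju)).
    by rewrite mulmxA !mulmxV// unitmx_mul Ju.
  by rewrite mulmxN mulmxA E mulmxDr mulKmx// opprD addrA subrr add0r.
have -> : invmx J = diag_mx (\row_j ds j (s (inr j))).
  apply: (can_inj (mulKmx Ju)); rewrite mulmxV//; apply/matrixP => a b.
  rewrite mul_diag_mx !mxE; case: eqP => [->|_]; last by rewrite !mulr0n mulr0.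
  by rewrite !mulr1n mulVf.
rewrite [LHS]mxE mul_diag_mx [in LHS]mxE [X in - (X * _)]mxE /w.
rewrite -mulmxA scalemxAr [(D _ *m _) _ _]D_mul /=.
have -> : k2 *: ((gain s)^T *m (drift s + k1 *: error s)) =
  (gain s)^T *m (error s + k2 *: drift s).
  rewrite scalemxAr scalerDr scalerA hk2 mulVf ?gt_eqF// scale1r addrC //.
by ring.
Qed.

(** Solving the velocity equation for [u] shows that [u] vanishes with
    [x2'] and [f2], provided that [g2] stays away from singular matrices. *)
Lemma control_inputE s :
  let x := (position s, velocity s) in
  control sigma g1 f2 g2 xb1 xb2 k1 k2 x1d
     (lifted sigma xb1 x.1) (lifted sigma xb2 x.2) =
  invmx (g2 x) *m ((\col_i (xb2 i 0 * (ds i (s (inr i)) * field s (inr i)))) - f2 x).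
Proof.
move=> x; have [_ g2u] := hns (safe_state s).
set u := control _ _ _ _ _ _ _ _ _ _ _.
have -> : \col_i (xb2 i 0 * (ds i (s (inr i)) * field s (inr i))) = f2 x + g2 x *m u.
  by apply/colP => i; rewrite mxE velocity_field.
by rewrite addrC addKr mulKmx.
Qed.

End ClosedLoopField.

(** * Energy and global boundedness *)

Section Potential.
Context {R : realType}.

Lemma clipN (r x : R) : 0 <= r -> clip r (- x) = - clip r x.
Proof.
move=> r0; rewrite /clip !maxEle !minEle.
case: (leP r x) => ?; case: (leP r (- x)) => ?; case: (leP (- r) r) => ?;
  case: (leP (- r) x) => ?; case: (leP (- r) (- x)) => ?; lra.
Qed.

Lemma clip_le (r x : R) : 0 <= r -> 0 <= x -> clip r x <= x.
Proof.
move=> r0 x0; rewrite /clip !maxEle !minEle.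
by case: (leP r x) => ?; case: (leP (- r) r) => ?; case: (leP (- r) x) => ?; lra.
Qed.

Lemma clip_ge (r x y : R) : y <= r -> y <= x -> y <= clip r x.
Proof. by move=> yr yx; rewrite /clip le_max le_min yr yx orbT. Qed.

Lemma clip_continuous (r : R) : continuous (clip r).
Proof.
move=> x; apply/cvgrPdist_le => e e0; near=> y.
apply: le_trans (clip_lipschitz _ _ _) _.
by near: y; exists e => //= y /ltW.
Unshelve. all: by end_near. Qed.

(** Potentials of the truncated system.  The two-sided growth bound does not
    mention [r]: the upper bound controls the initial energy, and the lower one
    turns an energy bound into a bound on the state, so that the level [r] can
    be chosen afterwards. *)
Lemma clipped_potential (f : R -> R) (r : R) : 1 <= r ->
  continuous f -> {homo f : x y / x <= y} -> (forall x, f (- x) = - f x) ->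
  exists S : R -> R, [/\ forall x : R, is_derive x 1 S (f (clip r x)),
    forall x, 0 <= S x,
    forall x, (`|x| - 1) * f 1 <= S x &
    forall x, S x <= `|x| * f `|x|].
Proof.
move=> r1 fc fle fN.
have r0 : 0 <= r by lra.
have f0 : f 0 = 0 by have := fN 0; rewrite oppr0; lra.
have cc : continuous (fun x => f (clip r x)).
  move=> x; apply: (@continuous_comp _ _ _ (clip r) f); [exact: clip_continuous|exact: fc].
have [S S0 Sd] := primitive_exists cc.
have SN x : S (- x) = S x.
  have Sd' (y : R) : is_derive y 1 (fun z => S (- z)) (f (clip r y)).
    have -> : f (clip r y) = f (clip r (- y)) * - 1 by rewrite clipN// fN; ring.
    exact: (is_derive1_comp (Sd (- y)) (is_deriveNid y 1)).
  apply: (@eq_derive_segment _ _ _ (fun y => f (clip r y)) (`|x| + 1) x (fun y _ => Sd' y) (fun y _ => Sd y)).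
    by rewrite oppr0.
  by rewrite -ltr_norml ltrDl.
have mvt x y : x <= y -> exists2 c, x <= c <= y & S y - S x = f (clip r c) * (y - x).
  move=> xy; have [c /[!in_itv]/= cxy E] := MVT_segment xy (fun z _ => Sd z)
    (derive_continuous_within (fun z _ => Sd z)).
  by exists c.
have Spos x : 0 <= x -> 0 <= S x.
  move=> x0; have [c /andP[c0 _]] := mvt 0 x x0; rewrite S0 !subr0 => ->.
  by rewrite mulr_ge0// -f0 fle// clip_ge.
have f1 : 0 <= f 1 by rewrite -f0 fle.
have Slow x : 0 <= x -> (x - 1) * f 1 <= S x.
  move=> x0; have [x1|/ltW x1] := leP 1 x; last first.
    by rewrite (@le_trans _ _ 0)// ?Spos// mulr_le0_ge0// subr_le0.
  have [c /andP[c1 _] E] := mvt 1 x x1.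
  have : f 1 <= f (clip r c) by rewrite fle// clip_ge.
  have := Spos 1 ler01; nra.
have Sup x : 0 <= x -> S x <= x * f x.
  move=> x0; have [c /andP[c0 cx]] := mvt 0 x x0; rewrite S0 !subr0 => ->.
  by rewrite mulrC ler_wpM2l// fle// (le_trans (clip_le _ _)).
have Sabs x : S x = S `|x| by case: (ger0P x) => //; rewrite SN.
exists S; split=> // x; rewrite Sabs.
- exact: Spos.
- by have := Slow `|x| (normr_ge0 _).
- exact: Sup.
Qed.

End Potential.

Section Lyapunov.
Context {R : realType} (n : nat) (sigma : 'I_n -> R -> R).
Context (g1 : 'cV[R]_n -> 'M[R]_n) (xb1 xb2 x1d : 'cV[R]_n) (k2 : R).
Hypothesis hsigma : forall i, strictly_increasing_sigmoid (sigma i).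
Hypothesis hg1 : continuously_differentiable g1.
Hypothesis hk2 : 0 < k2.

Notation state := (@state R n).
Notation gain := (gain sigma g1 xb1 xb2 x1d).
Notation drift := (drift sigma g1 xb1 xb2 x1d).
Notation field := (field sigma g1 xb1 xb2 x1d k2).
Notation box r := [set s : state | forall j, `|s j| <= r].

Lemma zeta_lipschitz (r : R) (i : 'I_n) : lipschitz_bounded (box r) (fun s => zeta sigma xb1 x1d s i).
Proof.
apply: lipschitz_boundedM; last exact: lipschitz_bounded_cst.
by apply: lipschitz_boundedD; [exact: lipschitz_bounded_coord|exact: lipschitz_bounded_cst].
Qed.

Lemma gain_lipschitz (r : R) (i j : 'I_n) : lipschitz_bounded (box r) (fun s => gain s i j).
Proof.
apply: (eq_lipschitz_bounded (fun s => gainE _ _ _ _ _ s i j)).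
apply: lipschitz_boundedM; last exact: lipschitz_bounded_cst.
apply: lipschitz_boundedM.
  apply: (lipschitz_bounded_comp (inv_sigmoid_derive_locally_lipschitz (hsigma i))).
  exact: zeta_lipschitz.
apply: lipschitz_bounded_comp_cV => // k.
apply: lipschitz_boundedM; first exact: lipschitz_bounded_cst.
by apply: (lipschitz_bounded_comp (sigmoid_locally_lipschitz (hsigma k))); exact: zeta_lipschitz.
Qed.

Lemma drift_lipschitz (r : R) (i : 'I_n) : lipschitz_bounded (box r) (fun s => drift s i 0).
Proof.
apply: (eq_lipschitz_bounded (fun s => driftE _ _ _ _ _ s i)).
apply: lipschitz_bounded_sum => j; apply: lipschitz_boundedM; first exact: gain_lipschitz.
apply: (lipschitz_bounded_comp (sigmoid_locally_lipschitz (hsigma j))).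
exact: lipschitz_bounded_coord.
Qed.

Lemma field_lipschitz (r : R) k : lipschitz_bounded (box r) (field^~ k).
Proof.
case: k => [i|i]; first exact: drift_lipschitz.
apply: (eq_lipschitz_bounded (fun s => field_inrE _ _ _ _ _ _ s i)).
apply: lipschitz_boundedN; apply: lipschitz_bounded_sum => j.
apply: lipschitz_boundedM; first exact: gain_lipschitz.
apply: lipschitz_boundedD; first exact: lipschitz_bounded_coord.
by apply: lipschitz_boundedM; [exact: lipschitz_bounded_cst|exact: drift_lipschitz].
Qed.

(** The derivatives of the potentials of the energy, one for each coordinate. *)
Definition slope (k : 'I_n + 'I_n) : R -> R :=
  match k with inl _ => id | inr i => sigma i end.

(** The exchange of [e] and [v] through [A] and [- A^T] cancels; only the
    dissipation is left. *)
Lemma energy_identity (s : state) :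
  \sum_k slope k (s k) * field s k = - k2 * \sum_i drift s i 0 ^+ 2.
Proof.
rewrite big_sumType /=.
rewrite [X in _ + X](_ : _ = - \sum_j drift s j 0 * (s (inl j) + k2 * drift s j 0)).
  rewrite -sumrN -big_split mulr_sumr; apply: eq_bigr => j _ /=; ring.
rewrite -sumrN; under eq_bigr => i _.
  rewrite -[X in _ * X]/(field s (inr i)) field_inrE mulrN mulr_sumr -sumrN; over.
rewrite exchange_big; apply: eq_bigr => j _.
by rewrite [X in - (X * _)]driftE mulr_suml -sumrN; apply: eq_bigr => i _; ring.
Qed.

(** The conclusion keeps the energy [V] because its monotonicity drives the
    convergence proof as well. *)
Lemma bounded_solution_exists (s0 : state) : exists (s : R -> state) (r : R) (V : R -> R),
  [/\ s 0 = s0, forall t k, 0 <= t -> `|s t k| <= r,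
    forall (t : R) k, 0 <= t -> is_derive t 1 (s^~ k) (field (s t) k),
    forall t, 0 <= t -> 0 <= V t &
    forall t : R, 0 <= t -> is_derive t 1 V (- k2 * \sum_i drift (s t) i 0 ^+ 2)].
Proof.
have slope1 k : 0 < slope k 1.
  by case: k => [i|i] //=; rewrite -(sigmoid0 (hsigma i)) sigmoid_lt.
have slopeN k x : slope k (- x) = - slope k x.
  by case: k => [i|i] //=; exact: sigmoidN.
have slopec k : continuous (slope k).
  by case: k => [i|i] x; [exact: cvg_id|exact: (sigmoid_continuous (hsigma i))].
have slopele k : {homo slope k : x y / x <= y}.
  case: k => [i|i] x y //=; rewrite le_eqVlt => /predU1P[->//|xy].
  by apply: ltW; exact: sigmoid_lt.
have slope0 k : slope k 0 = 0 by have := slopeN k 0; rewrite oppr0; lra.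
pose c := \sum_k `|s0 k| * slope k `|s0 k|.
have c0 : 0 <= c.
  by apply: sumr_ge0 => k _; rewrite mulr_ge0// -(slope0 k) slopele.
(* If [`|x| > r] then the potential of any coordinate at [x] exceeds [c], the
   bound on the initial energy; [1 <= r] is needed for the growth bound. *)
pose r := 1 + \sum_k c / slope k 1.
have q0 k : 0 <= c / slope k 1 by rewrite divr_ge0// ltW.
have r1 : 1 <= r by rewrite lerDl sumr_ge0.
have r0 : 0 <= r by lra.
have [L L0 FL] := sup_lipschitz_clip r0 (field_lipschitz r).
have [s [ss0 sd]] := picard_lindelof s0 L0 FL.
have /choice[S SP] k := clipped_potential r1 (slopec k) (@slopele k) (slopeN k).
pose p t : state := fun k => clip r (s t k).
pose V t := \sum_k S k (s t k).
have Vd (t : R) : 0 <= t -> is_derive t 1 V (- k2 * \sum_i drift (p t) i 0 ^+ 2).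
  move=> t0; rewrite -energy_identity; apply: is_derive1_sum => k.
  have [Sd _ _ _] := SP k.
  exact: (is_derive1_comp (Sd (s t k)) (sd t k t0)).
have Vle t : 0 <= t -> V t <= c.
  move=> t0; have : V t <= V 0.
    apply: (nonincreasing_derive t0 _ (fun x xt => Vd x (ltW (andP xt).1))).
      by apply: (derive_continuous_within (fun x xt => Vd x (andP xt).1)).
    move=> x _; rewrite mulNr oppr_le0; apply: mulr_ge0; first exact: ltW.
    by apply: sumr_ge0 => i _; exact: sqr_ge0.
  move=> /le_trans; apply; apply: ler_sum => k _.
  by have [_ _ _] := SP k; rewrite ss0; apply.
have sb t k : 0 <= t -> `|s t k| <= r.
  move=> t0; have [_ _ /(_ (s t k)) low _] := SP k.
  have Sk : S k (s t k) <= c.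
    apply: le_trans (Vle t t0); rewrite /V (bigD1 k)//= lerDl sumr_ge0// => j _.
    by have [_ + _ _] := SP j; apply.
  have : `|s t k| - 1 <= c / slope k 1 by rewrite ler_pdivlMr// (le_trans low).
  move=> h; rewrite -lerBlDl (le_trans h)// (bigD1 k)//= lerDl sumr_ge0//.
have pE t : 0 <= t -> p t = s t.
  by move=> t0; apply/funext => k; rewrite /p clip_id// sb.
exists s, r, V; split=> // [t k t0|t _|t t0].
- by have := sd t k t0; rewrite -/(p t) pE.
- by apply: sumr_ge0 => k _; have [_ + _ _] := SP k; apply.
- by have := Vd t t0; rewrite pE.
Qed.

End Lyapunov.

(** * Convergence *)

Section MatrixInverse.
Context {R : realType}.

Lemma cvg_sum_seq (T : Type) (F : set_system T) {FF : Filter F} (J : Type) (r : seq J)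
    (f : J -> T -> R) (l : J -> R) :
  (forall j, f j x @[x --> F] --> l j) ->
  \sum_(j <- r) f j x @[x --> F] --> \sum_(j <- r) l j.
Proof.
move=> fl; elim: r => [|j r IH].
  by rewrite big_nil; under eq_fun do rewrite big_nil; exact: cvg_cst.
by rewrite big_cons; under eq_fun do rewrite big_cons; exact: cvgD.
Qed.

Lemma cvg_prod_seq (T : Type) (F : set_system T) {FF : Filter F} (J : Type) (r : seq J)
    (f : J -> T -> R) (l : J -> R) :
  (forall j, f j x @[x --> F] --> l j) ->
  \prod_(j <- r) f j x @[x --> F] --> \prod_(j <- r) l j.
Proof.
move=> fl; elim: r => [|j r IH].
  by rewrite big_nil; under eq_fun do rewrite big_nil; exact: cvg_cst.
by rewrite big_cons; under eq_fun do rewrite big_cons; exact: cvgM.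
Qed.

Context (T : Type) (F : set_system T) {FF : Filter F}.

Lemma cvg_det n (A : T -> 'M[R]_n) (B : 'M[R]_n) :
  A x @[x --> F] --> B -> \det (A x) @[x --> F] --> \det B.
Proof.
move=> /cvg_mxP AB; apply: cvg_sum_seq => p; apply: cvgM; first exact: cvg_cst.
by apply: cvg_prod_seq => i; exact: AB.
Qed.

Lemma cvg_mulmx m n p (A : T -> 'M[R]_(m, n)) (A' : T -> 'M[R]_(n, p))
    (B : 'M[R]_(m, n)) (B' : 'M[R]_(n, p)) :
  A x @[x --> F] --> B -> A' x @[x --> F] --> B' ->
  A x *m A' x @[x --> F] --> B *m B'.
Proof.
move=> /cvg_mxP AB /cvg_mxP AB'; apply/cvg_mxP => i j.
rewrite mxE; under eq_fun do rewrite mxE.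
by apply: cvg_sum_seq => k; exact: cvgM.
Qed.

(** Near [B] the determinant is nonzero, so that [invmx] is given by the
    adjugate formula, a rational function of the entries. *)
Lemma cvg_invmx n (A : T -> 'M[R]_n) (B : 'M[R]_n) : B \in unitmx ->
  A x @[x --> F] --> B -> invmx (A x) @[x --> F] --> invmx B.
Proof.
move=> uB AB; have dB : \det B != 0 by rewrite -unitfE -unitmxE.
have dAB := cvg_det AB.
have : (\det (A x))^-1 *: \adj (A x) @[x --> F] --> invmx B.
  rewrite /invmx uB; apply: cvgZ; first exact: cvgV.
  apply/cvg_mxP => i j; rewrite mxE; under eq_fun do rewrite mxE.
  apply: cvgM; first exact: cvg_cst.
  apply: cvg_det; apply/cvg_mxP => k l; rewrite !mxE.
  by under eq_fun do rewrite !mxE; exact: (cvg_mxP _ _ _).1 AB _ _.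
apply: cvg_trans; apply: near_eq_cvg; near=> x.
rewrite /invmx unitmxE unitfE; case: ifPn => //.
suff -> : \det (A x) != 0 by [].
rewrite -normr_gt0; near: x.
have /cvgrPdist_lt/(_ `|\det B|) := dAB; rewrite normr_gt0 => /(_ dB).
apply: filterS => x; rewrite !normr_gt0 => h; apply/eqP => E.
by move: h; rewrite E subr0 ltxx.
Unshelve. all: by end_near. Qed.

Lemma cvg0_le (f g : T -> R) (c : R) : (\forall x \near F, `|f x| <= c * `|g x|) ->
  g x @[x --> F] --> 0 -> f x @[x --> F] --> 0.
Proof.
move=> fg g0; apply/cvgrPdist_le => e e0.
have c0 : 0 < `|c| + 1 by rewrite ltr_pwDr.
have /cvgrPdist_le/(_ (e / (`|c| + 1))) := g0; rewrite divr_gt0// => /(_ isT).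
apply: filterS2 fg => x fg; rewrite !sub0r !normrN ler_pdivlMr// => h.
apply: le_trans fg _; apply: le_trans h.
by rewrite mulrC ler_wpM2l// (le_trans (ler_norm _))// lerDl.
Qed.

Lemma cvg0_bounded (f g : T -> R) (c : R) : (\forall x \near F, `|f x| <= c) ->
  g x @[x --> F] --> 0 -> f x * g x @[x --> F] --> 0.
Proof.
move=> fc; apply: (@cvg0_le _ _ c); apply: filterS fc => x fc.
by rewrite normrM ler_wpM2r.
Qed.

Lemma cvg0_sum (J : Type) (r : seq J) (f : J -> T -> R) :
  (forall j, f j x @[x --> F] --> 0) -> \sum_(j <- r) f j x @[x --> F] --> 0.
Proof.
move=> f0; have := @cvg_sum_seq T F FF J r f (fun=> 0) f0.
by rewrite big1.
Qed.

Lemma cvg0Ml (c : R) (g : T -> R) : g x @[x --> F] --> 0 -> c * g x @[x --> F] --> 0.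
Proof. by move=> g0; apply: (@cvg0_bounded _ _ `|c|) => //; exact: nearW. Qed.

End MatrixInverse.

Section Convergence.
Context {R : realType} (n : nat) (sigma : 'I_n -> R -> R).
Context (g1 : 'cV[R]_n -> 'M[R]_n) (xb1 xb2 x1d : 'cV[R]_n) (k2 : R).
Hypothesis hsigma : forall i, strictly_increasing_sigmoid (sigma i).
Hypothesis hg1 : continuously_differentiable g1.
Hypothesis hk2 : 0 < k2.
Hypothesis hxb2 : forall i, 0 < xb2 i 0.

Notation state := (@state R n).
Notation gain := (gain sigma g1 xb1 xb2 x1d).
Notation drift := (drift sigma g1 xb1 xb2 x1d).
Notation field := (field sigma g1 xb1 xb2 x1d k2).
Notation position := (position sigma xb1 x1d).
Notation zeta := (zeta sigma xb1 x1d).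
Notation box r := [set s : state | forall j, `|s j| <= r].
Hypothesis hunit : forall s : state, g1 (position s) \in unitmx.

(* The position depends on the error only, which is a vector: this is how the
   compactness of boxes of vectors is used. *)
Let embed (e : 'cV[R]_n) : state :=
  fun k => match k with inl i => e i 0 | inr _ => 0 end.

Lemma position_embed_continuous : continuous (fun e => position (embed e)).
Proof.
move=> e; apply: continuous_mx => i j.
have -> : (fun e => position (embed e) i j) =
    (fun e => xb1 i 0 * sigma i (zeta (embed e) i)).
  by apply/funext => y; rewrite mxE.
apply: continuousM; first exact: cst_continuous.
apply: (@continuous_comp _ _ _ (fun e => zeta (embed e) i) (sigma i)); last exact: (sigmoid_continuous (hsigma i)).
apply: continuousM; last exact: cst_continuous.
by apply: continuousD; [exact: coord_continuous|exact: cst_continuous].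
Qed.

Lemma inverse_bounded (r : R) : exists C, forall s, (forall i, `|s (inl i)| <= r) ->
  forall i j, `|invmx (g1 (position s)) i j| <= C.
Proof.
have gc : continuous g1 by move=> x; have [gd _] := hg1; exact: differentiable_continuous.
pose f (ij : 'I_n * 'I_n) e := invmx (g1 (position (embed e))) ij.1 ij.2.
have fc ij : continuous (f ij).
  move=> e.
  have ge : {for e, continuous (fun e => g1 (position (embed e)))}.
    exact: (continuous_comp (@position_embed_continuous e) (gc _)).
  have /cvg_mxP := @cvg_invmx _ _ (nbhs e) (nbhs_filter e) n _ _ (hunit (embed e)) ge.
  by move=> /(_ ij.1 ij.2).
have /choice[K KP] : forall ij, exists K, forall e : 'cV[R]_n, (forall i, `|e i 0| <= r) -> `|f ij e| <= K.
  by move=> ij; apply: continuous_box_bounded => e _; exact: fc.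
exists (\sum_ij `|K ij|) => s sr i j.
have -> : position s = position (embed (error s)).
  by apply: eq_position => l; rewrite /= mxE.
apply: le_trans (KP (i, j) (error s) _) _; first by move=> l; rewrite mxE.
by rewrite (le_trans (ler_norm _))// (bigD1 (i, j))//= lerDl sumr_ge0.
Qed.

Variables (s : R -> state) (r : R) (V : R -> R).
Hypothesis sr : forall t k, 0 <= t -> `|s t k| <= r.
Hypothesis sd : forall (t : R) k, 0 <= t -> is_derive t 1 (s^~ k) (field (s t) k).
Hypothesis V0 : forall t, 0 <= t -> 0 <= V t.
Hypothesis Vd : forall t : R, 0 <= t ->
  is_derive t 1 V (- k2 * \sum_i drift (s t) i 0 ^+ 2).

Lemma lipschitz_along (h : state -> R) : lipschitz_bounded (box r) h ->
  exists L, forall a b, 0 <= a -> 0 <= b -> `|h (s a) - h (s b)| <= L * `|a - b|.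
Proof.
move=> [H [H0 _ hL]].
have /choice[K KP] := field_lipschitz xb1 xb2 x1d k2 hsigma hg1 r.
have K0 k : 0 <= K k by have [] := KP k.
pose M := \sum_k K k.
have sL a b k : 0 <= a -> 0 <= b -> `|s a k - s b k| <= M * `|a - b|.
  wlog ab : a b / a <= b => [W a0 b0|a0 b0].
    have [ab|/ltW ba] := leP a b; first exact: W.
    by rewrite distrC [`|a - b|]distrC W.
  have fd (z : R) : z \in `]a, b[ -> is_derive z 1 (s^~ k) (field (s z) k).
    by rewrite in_itv/= => /andP[az _]; apply: sd; rewrite (le_trans a0)// ltW.
  have fc : {within `[a, b], continuous (s^~ k)}.
    by apply: (derive_continuous_within (fun z zab => sd k (le_trans a0 (andP zab).1))).
  have [c /[!in_itv]/= /andP[ac _] E] := MVT_segment ab fd fc.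
  rewrite distrC E normrM [`|a - b|]distrC ler_wpM2r//.
  have [_ kb _] := KP k.
  apply: le_trans (kb (s c) _) _; first by move=> j; apply: sr; exact: le_trans ac.
  by rewrite /M (bigD1 k)//= lerDl sumr_ge0.
exists (H * M) => a b a0 b0; rewrite -mulrA; apply: hL.
- by move=> j; exact: sr.
- by move=> j; exact: sr.
- by rewrite mulr_ge0// sumr_ge0.
- by move=> k; exact: sL.
Qed.

(** Barbalat's lemma for the energy, which is nonincreasing and nonnegative. *)
Lemma drift_cvg0 i : drift (s t) i 0 @[t --> +oo] --> 0.
Proof.
pose W t := - V (Num.max t 0).
have W_nd : {homo W : x y / x <= y}.
  move=> x y xy; rewrite /W lerN2.
  have mx0 z : 0 <= Num.max z 0 :> R by rewrite le_max lexx orbT.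
  have mxy : Num.max x 0 <= Num.max y 0 by rewrite ge_max !le_max xy lexx !orbT.
  apply: (nonincreasing_derive mxy _ (fun z zxy => Vd (le_trans (mx0 x) (ltW (andP zxy).1)))).
    by apply: (derive_continuous_within (fun z zxy => Vd (le_trans (mx0 x) (andP zxy).1))).
  move=> z _; rewrite mulNr oppr_le0; apply: mulr_ge0; first exact: ltW.
  by apply: sumr_ge0 => j _; exact: sqr_ge0.
have Wub : has_ubound (range W).
  by exists 0 => _ [t _ <-]; rewrite oppr_le0 V0// le_max lexx orbT.
have Wcvg := nondecreasing_cvgr W_nd Wub.
have Vcvg : V t @[t --> +oo] --> - sup (range W).
  apply: cvg_trans (cvgN Wcvg); apply: near_eq_cvg; near=> t.
  by rewrite /W opprK max_l.
have sq_lip : lipschitz_bounded (box r) (fun s => - k2 * \sum_i drift s i 0 ^+ 2).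
  apply: lipschitz_boundedM; first exact: lipschitz_bounded_cst.
  apply: lipschitz_bounded_sum => j.
  by apply: lipschitz_boundedM; exact: drift_lipschitz.
have [L HL] := lipschitz_along sq_lip.
have := barbalat Vcvg Vd HL => h.
apply/cvgrPdist_le => e e0.
have /cvgrPdist_le/(_ (k2 * e ^+ 2)) := h; rewrite mulr_gt0 ?exprn_gt0// => /(_ isT).
apply: filterS => t; rewrite !sub0r !normrN normrM normrN (gtr0_norm hk2) ler_pM2l// => h2.
rewrite -(ler_pXn2r (n := 2))// ?nnegrE// ?(ltW e0)//.
rewrite -normrX ger0_norm ?sqr_ge0//.
apply: le_trans h2; rewrite ger0_norm; last by apply: sumr_ge0 => j _; exact: sqr_ge0.
by rewrite (bigD1 i)//= lerDl sumr_ge0// => j _; exact: sqr_ge0.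
Unshelve. all: by end_near. Qed.

Lemma near_box (P : state -> Prop) : (forall x, box r x -> P x) ->
  \forall t \near +oo, P (s t).
Proof. by move=> BP; near=> t; apply: BP => j; exact: sr. Unshelve. all: by end_near. Qed.

Lemma box_mul_cvg0 (h : state -> R) (C : R) (g : R -> R) :
  (forall x, box r x -> `|h x| <= C) -> g t @[t --> +oo] --> 0 ->
  h (s t) * g t @[t --> +oo] --> 0.
Proof.
by move=> hC; exact: (cvg0_bounded (near_box (P := fun x => `|h x| <= C) hC)).
Qed.

Lemma sigmoid_derive_bounded i : exists C, forall x, box r x ->
  `|((sigma i)^`())%classic (zeta x i)| <= C.
Proof.
have dl := derive_locally_lipschitz (sigmoid_derive2 (hsigma i))
  (sigmoid_derive2_continuous (hsigma i)).
have [C [_ Cb _]] := lipschitz_bounded_comp dl (zeta_lipschitz sigma xb1 x1d r i).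
by exists C.
Qed.

(** [g1 x1 *m x2] is [drift] rescaled by the bounded slopes of the sigmoids, and
    [g1 x1] has a bounded inverse along the trajectory. *)
Lemma lifted_velocity_cvg0 i : s t (inr i) @[t --> +oo] --> 0.
Proof.
pose w t : 'cV[R]_n := \col_j (xb2 j 0 * sigma j (s t (inr j))).
have gw j : (g1 (position (s t)) *m w t) j 0 @[t --> +oo] --> 0.
  under eq_fun do rewrite (position_field g1 xb1 xb2 x1d k2 hsigma).
  have [C Cb] := sigmoid_derive_bounded j.
  by apply: (box_mul_cvg0 Cb); exact: drift_cvg0.
have [C CP] := inverse_bounded r.
have w0 j : w t j 0 @[t --> +oo] --> 0.
  have wE t : w t j 0 = \sum_l invmx (g1 (position (s t))) j l * (g1 (position (s t)) *m w t) l 0.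
    by rewrite -[in LHS](mulKmx (hunit (s t)) (w t)) mxE.
  under eq_fun do rewrite wE.
  apply: cvg0_sum => l; apply: (@box_mul_cvg0 (fun x => invmx (g1 (position x)) j l) C) => //.
  by move=> x xr; apply: CP => k; exact: xr.
have sE t : s t (inr i) = Defs.eta (sigma i) (w t i 0 / xb2 i 0).
  by rewrite mxE mul_div_cancel// sigmoidK.
under eq_fun do rewrite sE.
rewrite -(eta0 (hsigma i)).
have q0 : w t i 0 / xb2 i 0 @[t --> +oo] --> 0.
  by under eq_fun do rewrite mulrC; exact: cvg0Ml.
have := eta_continuous (hsigma i) (y := 0); rewrite normr0 => /(_ ltr01) ec.
exact: (cvg_comp _ _ q0 ec).
Qed.

Lemma field_cvg0 k : field (s t) k @[t --> +oo] --> 0.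
Proof.
case: k => [i|i]; first exact: drift_cvg0.
have [L HL] := lipschitz_along (field_lipschitz xb1 xb2 x1d k2 hsigma hg1 r (inr i)).
exact: barbalat (lifted_velocity_cvg0 i) (fun t => @sd t (inr i)) HL.
Qed.

(** As [zeta2'] and [drift] vanish in the limit, so does [A^T e]; here
    [A^T e = D xb2 *m (g1 x1)^T *m p], where [p] is [e] divided by the slopes of the
    sigmoids. *)
Lemma error_cvg0 i : s t (inl i) @[t --> +oo] --> 0.
Proof.
pose p t : 'cV[R]_n := \col_j ((((sigma j)^`())%classic (zeta (s t) j))^-1 * s t (inl j)).
have gp j : ((g1 (position (s t)))^T *m p t) j 0 @[t --> +oo] --> 0.
  have E t : ((g1 (position (s t)))^T *m p t) j 0 =
      (- field (s t) (inr j) - k2 * \sum_l gain (s t) l j * drift (s t) l 0) / xb2 j 0.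
    rewrite field_inrE opprK mulr_sumr -sumrB mxE mulr_suml; apply: eq_bigr => l _.
    rewrite [X in X * _]mxE [X in _ * X]mxE gainE; field.
    by rewrite !gt_eqF// sigmoid_derive_gt0.
  under eq_fun do rewrite E.
  under eq_fun do rewrite mulrC; apply: cvg0Ml.
  have c0 (a b : R -> R) : a t @[t --> +oo] --> 0 -> b t @[t --> +oo] --> 0 ->
      - a t - b t @[t --> +oo] --> 0.
    move=> a0 b0; rewrite -(addr0 0) -{1}oppr0 -[X in _ + X]oppr0.
    by apply: cvgD; apply: cvgN.
  apply: c0; first exact: field_cvg0.
  apply: cvg0Ml.
  apply: cvg0_sum => l.
  have [C [_ Cb _]] := gain_lipschitz xb1 xb2 x1d hsigma hg1 r l j.
  by apply: (box_mul_cvg0 Cb); exact: drift_cvg0.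
have [C CP] := inverse_bounded r.
have p0 j : p t j 0 @[t --> +oo] --> 0.
  have uT t : (g1 (position (s t)))^T \in unitmx by rewrite unitmx_tr.
  have pE t : p t j 0 = \sum_l invmx (g1 (position (s t))) l j * ((g1 (position (s t)))^T *m p t) l 0.
    rewrite -[in LHS](mulKmx (uT t) (p t)) mxE -trmx_inv.
    by apply: eq_bigr => l _; rewrite [X in X * _]mxE.
  under eq_fun do rewrite pE.
  apply: cvg0_sum => l; apply: (@box_mul_cvg0 (fun x => invmx (g1 (position x)) l j) C) => //.
  by move=> x xr; apply: CP => k; exact: xr.
have sE t : s t (inl i) = ((sigma i)^`())%classic (zeta (s t) i) * p t i 0.
  by rewrite mxE mulVKf// gt_eqF// sigmoid_derive_gt0.
under eq_fun do rewrite sE.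
have [C' Cb] := sigmoid_derive_bounded i.
by apply: (box_mul_cvg0 Cb).
Qed.

End Convergence.

(** * From lifted coordinates to trajectories, and uniqueness *)

Section Trajectories.
Context {R : realType} (n : nat) (sigma : 'I_n -> R -> R).
Context (g1 : 'cV[R]_n -> 'M[R]_n) (f2 : 'cV[R]_n * 'cV[R]_n -> 'cV[R]_n).
Context (g2 : 'cV[R]_n * 'cV[R]_n -> 'M[R]_n) (xb1 xb2 x1d : 'cV[R]_n) (k1 k2 : R).
Hypothesis hsigma : forall i, strictly_increasing_sigmoid (sigma i).
Hypothesis hxb1 : forall i, 0 < xb1 i 0.
Hypothesis hxb2 : forall i, 0 < xb2 i 0.
Hypothesis hg1 : continuously_differentiable g1.
Hypothesis hk1 : 0 < k1.
Hypothesis hk2 : k2 = k1^-1.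
Hypothesis hns : forall x1 x2 : 'cV[R]_n, safe xb1 xb2 (x1, x2) ->
       g1 x1 \in unitmx /\ g2 (x1, x2) \in unitmx.

Notation state := (@state R n).
Notation field := (field sigma g1 xb1 xb2 x1d k2).
Notation position := (position sigma xb1 x1d).
Notation velocity := (velocity sigma xb2).
Notation state_of := (state_of sigma xb1 xb2 x1d).
Notation u_of x1 x2 := (control sigma g1 f2 g2 xb1 xb2 k1 k2 x1d
     (lifted sigma xb1 x1) (lifted sigma xb2 x2)).

Lemma position_derive (s : R -> state) (t : R) :
  (forall k, is_derive t 1 (s^~ k) (field (s t) k)) ->
  is_derive t 1 (fun t => position (s t)) (g1 (position (s t)) *m velocity (s t)).
Proof.
move=> sd; apply/is_derive_mxP => i j; rewrite (ord1 j).
rewrite (position_field g1 xb1 xb2 x1d k2 hsigma).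
have -> : (fun t => position (s t) i 0) = (fun t => xb1 i 0 * sigma i (zeta sigma xb1 x1d (s t) i)).
  by apply/funext => r; rewrite mxE.
have zd : is_derive t 1 (fun t => zeta sigma xb1 x1d (s t) i) ((xb1 i 0)^-1 * (field (s t) (inl i) + 0)).
  have := is_derive1Z (xb1 i 0)^-1 (is_derive1D (sd (inl i)) (is_derive_cst (lifted sigma xb1 x1d i 0) _ _)).
  by under eq_fun do rewrite mulrC.
have := is_derive1Z (xb1 i 0) (is_derive1_comp (sigmoid_derive (hsigma i) _) zd).
move/is_derive_eq; apply; rewrite addr0; field; exact: lt0r_neq0.
Qed.

Lemma velocity_derive (s : R -> state) (t : R) :
  (forall k, is_derive t 1 (s^~ k) (field (s t) k)) ->
  is_derive t 1 (fun t => velocity (s t)) (f2 (position (s t), velocity (s t)) +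
    g2 (position (s t), velocity (s t)) *m u_of (position (s t)) (velocity (s t))).
Proof.
move=> sd; apply/is_derive_mxP => i j; rewrite (ord1 j).
rewrite (velocity_field f2 x1d hsigma hxb1 hxb2 hk1 hk2 hns).
have -> : (fun t => velocity (s t) i 0) = (fun t => xb2 i 0 * sigma i (s t (inr i))).
  by apply/funext => r; rewrite mxE.
exact: (is_derive1Z _ (is_derive1_comp (sigmoid_derive (hsigma i) _) (sd (inr i)))).
Qed.

Lemma state_of_derive (y1 y2 : R -> 'cV[R]_n) (t : R) :
  safe xb1 xb2 (y1 t, y2 t) -> is_derive t 1 y1 (g1 (y1 t) *m y2 t) ->
  is_derive t 1 y2 (f2 (y1 t, y2 t) + g2 (y1 t, y2 t) *m u_of (y1 t) (y2 t)) ->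
  forall k, is_derive t 1 (fun t => state_of (y1 t) (y2 t) k) (field (state_of (y1 t) (y2 t)) k).
Proof.
move=> sy /is_derive_mxP dy1 /is_derive_mxP dy2.
set s := state_of (y1 t) (y2 t).
have E1 : position s = y1 t by exact: position_state_of.
have E2 : velocity s = y2 t by exact: velocity_state_of.
have [sy1 sy2] := sy.
case=> i.
  have ed := eta_derive (hsigma i) (ratio_lt1 (hxb1 i) (sy1 i)).
  have yd : is_derive t 1 (fun t => y1 t i 0 / xb1 i 0) ((xb1 i 0)^-1 * (g1 (y1 t) *m y2 t) i 0).
    have := is_derive1Z (xb1 i 0)^-1 (dy1 i 0).
    by under eq_fun do rewrite mulrC.
  have := is_derive1B (is_derive1Z (xb1 i 0) (@is_derive1_comp _ _ (fun t => y1 t i 0 / xb1 i 0) t _ _ ed yd))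
    (is_derive_cst (lifted sigma xb1 x1d i 0) _ _).
  move/is_derive_eq; apply.
  rewrite -E1 -E2 (position_field g1 xb1 xb2 x1d k2 hsigma) E1.
  rewrite zeta_state_of// subr0; field.
  by rewrite lt0r_neq0//= lt0r_neq0// sigmoid_derive_gt0.
have ed := eta_derive (hsigma i) (ratio_lt1 (hxb2 i) (sy2 i)).
have yd : is_derive t 1 (fun t => y2 t i 0 / xb2 i 0) ((xb2 i 0)^-1 *
    (f2 (y1 t, y2 t) + g2 (y1 t, y2 t) *m u_of (y1 t) (y2 t)) i 0).
  have := is_derive1Z (xb2 i 0)^-1 (dy2 i 0).
  by under eq_fun do rewrite mulrC.
have := @is_derive1_comp _ _ (fun t => y2 t i 0 / xb2 i 0) t _ _ ed yd; move/is_derive_eq; apply.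
have := velocity_field f2 x1d hsigma hxb1 hxb2 hk1 hk2 hns s i.
rewrite E1 E2 => ->; rewrite -[s (inr i)]/(Defs.eta (sigma i) (y2 t i 0 / xb2 i 0)); field.
by rewrite lt0r_neq0//= lt0r_neq0// sigmoid_derive_gt0.
Qed.

Lemma cvg_state_of (T : Type) (F : set_system T) {FF : Filter F} (y1 y2 : T -> 'cV[R]_n) l1 l2 k :
  safe xb1 xb2 (l1, l2) -> y1 t @[t --> F] --> l1 -> y2 t @[t --> F] --> l2 ->
  state_of (y1 t) (y2 t) k @[t --> F] --> state_of l1 l2 k.
Proof.
move=> [s1 s2] /cvg_mxP c1 /cvg_mxP c2.
have ce i q (f : T -> R) l : 0 < q -> `|l| < q -> f t @[t --> F] --> l ->
    Defs.eta (sigma i) (f t / q) @[t --> F] --> Defs.eta (sigma i) (l / q).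
  move=> q0 lq fl.
  have fq : f t / q @[t --> F] --> l / q by apply: cvgM => //; exact: cvg_cst.
  exact: (cvg_comp _ _ fq (eta_continuous (hsigma i) (ratio_lt1 q0 lq))).
case: k => i /=; last exact: ce.
apply: cvgB; last exact: cvg_cst.
by apply: cvgM; [exact: cvg_cst|exact: ce].
Qed.

Variables (s : R -> state) (r : R).
Hypothesis sr : forall t k, 0 <= t -> `|s t k| <= r.
Hypothesis sd : forall (t : R) k, 0 <= t -> is_derive t 1 (s^~ k) (field (s t) k).

Variables (T : \bar R) (v y1 y2 : R -> 'cV[R]_n).
Hypothesis cl : closed_loop sigma g1 f2 g2 xb1 xb2 k1 k2 x1d T v y1 y2.

Lemma closed_loop_right_continuous (t : R) : 0 <= t -> (t%:E < T)%E ->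
  y1 r @[r --> t^'+] --> y1 t /\ y2 r @[r --> t^'+] --> y2 t.
Proof.
have [[c1 c2 d] _] := cl.
rewrite le_eqVlt => /predU1P[<- _ //|t0 tT].
have [d1 d2] := d t t0 tT.
have rc (y : R -> 'cV[R]_n) dy : is_derive t 1 y dy -> y r @[r --> t^'+] --> y t.
  by move=> yd; apply: cvg_at_right_filter; exact: (is_derive_continuous yd).
by split; [exact: rc d1|exact: rc d2].
Qed.

(** Agreement at time [t] implies that the trajectory is safe, with lifted
    coordinates below a slightly larger level [r'], on a right neighbourhood of
    [t].  The field truncated at [r'] governs both solutions there. *)
Lemma agreement_step (t t1 : R) : 0 <= t -> t < t1 -> (t1%:E < T)%E ->
  y1 t = position (s t) -> y2 t = velocity (s t) ->
  exists2 e, 0 < e & forall z, t <= z <= t + e ->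
    y1 z = position (s z) /\ y2 z = velocity (s z).
Proof.
move=> t0 tt1 t1T E1 E2.
have tT : (t%:E < T)%E by apply: lt_trans t1T; rewrite lte_fin.
have [rc1 rc2] := closed_loop_right_continuous t0 tT.
have syt : safe xb1 xb2 (y1 t, y2 t) by rewrite E1 E2; exact: safe_state.
have st : state_of (y1 t) (y2 t) = s t by rewrite E1 E2 state_of_state.
pose r' := `|r| + 1.
have r'0 : 0 <= r' by rewrite addr_ge0.
have rr' : r < r' by rewrite (le_lt_trans (ler_norm r))// ltrDl.
pose a z := state_of (y1 z) (y2 z).
have ac k : a z k @[z --> t^'+] --> a t k by exact: cvg_state_of.
have near_good : \forall z \near t^'+, [/\ safe xb1 xb2 (y1 z, y2 z),
    forall k, `|a z k| <= r' & z < t1].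
  have h1 : \forall z \near t^'+, forall i, `|y1 z i 0| < xb1 i 0.
    apply: (@filter_forall _ _ (fun i z => `|y1 z i 0| < xb1 i 0) (t^'+)) => i.
    have /cvg_mxP/(_ i 0) := rc1; move/cvgr_norm_lt; apply.
    by have [+ _] := syt; apply.
  have h2 : \forall z \near t^'+, forall i, `|y2 z i 0| < xb2 i 0.
    apply: (@filter_forall _ _ (fun i z => `|y2 z i 0| < xb2 i 0) (t^'+)) => i.
    have /cvg_mxP/(_ i 0) := rc2; move/cvgr_norm_lt; apply.
    by have [_ +] := syt; apply.
  have h3 : \forall z \near t^'+, forall k, `|a z k| <= r'.
    apply: (@filter_forall _ _ (fun k z => `|a z k| <= r') (t^'+)) => k.
    have := ac k; move/cvgr_norm_le; apply.
    by rewrite /a st (le_lt_trans (sr k t0)).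
  near=> z; split; [split| |].
  - by near: z.
  - by near: z.
  - by near: z.
  - by near: z; exact: nbhs_right_lt.
have [e /= e0 He] := near_good.
have good z : t < z -> z < t + e -> [/\ safe xb1 xb2 (y1 z, y2 z),
    forall k, `|a z k| <= r' & z < t1].
  by move=> tz ze; apply: He => //=; rewrite distrC gtr0_norm ?subr_gt0// ltrBlDl.
have [[_ _ yd] yu] := cl.
have ad z k : t < z -> z < t + e -> is_derive z 1 (a^~ k) (field (a z) k).
  move=> tz ze; have [sz _ zt1] := good z tz ze.
  have z0 : 0 < z by exact: le_lt_trans tz.
  have zT : (z%:E < T)%E by apply: lt_trans t1T; rewrite lte_fin.
  have [d1 d2] := yd z z0 zT.
  rewrite (yu z (ltW z0) zT sz) in d2.
  exact: state_of_derive.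
exists (e / 2); first exact: divr_gt0.
move=> z /andP[tz ze2].
have ze : z < t + e by apply: le_lt_trans ze2 _; rewrite ltrD2l ltr_pdivrMr// ltr_pMr// ltr1n.
suff az : a z = s z.
  have [z_eq_t|z_neq_t] := eqVneq z t; first by rewrite z_eq_t.
  have [sz _ _] := good z (ltac:(by rewrite lt_neqAle eq_sym z_neq_t)) ze.
  by rewrite -az position_state_of// velocity_state_of.
have [L _ FL] := sup_lipschitz_clip r'0 (field_lipschitz xb1 xb2 x1d k2 hsigma hg1 r').
have ca k : {within `[t, z], continuous (a^~ k)}.
  apply: (cvg_within_itvl tz (ac k)) => x tx xz.
  exact: (is_derive_continuous (ad x k tx (le_lt_trans xz ze))).
have cs k : {within `[t, z], continuous (s^~ k)}.
  exact: (derive_continuous_within (fun x xt => sd k (le_trans t0 (andP xt).1))).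
have da (x : R) k : t < x < z -> is_derive x 1 (a^~ k) (field (fun i => clip r' (a x i)) k).
  move=> /andP[tx xz]; have xe := lt_trans xz ze.
  have [_ ax _] := good x tx xe.
  rewrite (_ : (fun i => clip r' (a x i)) = a x); first exact: ad.
  by apply/funext => i; rewrite clip_id.
have ds (x : R) k : t < x < z -> is_derive x 1 (s^~ k) (field (fun i => clip r' (s x i)) k).
  move=> /andP[tx xz]; have x0 : 0 <= x by rewrite (le_trans t0)// ltW.
  rewrite (_ : (fun i => clip r' (s x i)) = s x); first exact: sd.
  by apply/funext => i; rewrite clip_id// (le_trans (sr i x0))// ltW.
exact: (lipschitz_ode_unique FL tz ca cs da ds st).
Unshelve. all: by end_near. Qed.

(** The supremum [c] of the times of agreement is a time of agreement by left
    continuity; [agreement_step] would extend the agreement beyond [c]. *)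
Lemma closed_loop_unique (t1 : R) : 0 <= t1 -> (t1%:E < T)%E ->
  y1 0 = position (s 0) -> y2 0 = velocity (s 0) ->
  y1 t1 = position (s t1) /\ y2 t1 = velocity (s t1).
Proof.
move=> t10 t1T E1 E2.
pose P t := y1 t = position (s t) /\ y2 t = velocity (s t).
pose A := [set t | 0 <= t <= t1 /\ forall z, 0 <= z <= t -> P z].
have A0 : A 0.
  split; first by rewrite lexx.
  by move=> z; rewrite -eq_le => /eqP <-.
have supA : has_sup A by split; [exists 0|exists t1 => t [/andP[]]].
pose c := sup A.
have c0 : 0 <= c by apply: ub_le_sup => //; have [] := supA.
have ct1 : c <= t1 by apply: ge_sup; [exists 0|move=> t [/andP[]]].
have Plt z : 0 <= z -> z < c -> P z.
  move=> z0 zc; have [t [_ At] zt] := sup_adherent (ltac:(by rewrite subr_gt0) : 0 < c - z) supA.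
  by apply: At; rewrite z0 ltW//; move: zt; rewrite -/c subKr.
have cT : (c%:E < T)%E by apply: le_lt_trans t1T; rewrite lee_fin.
have Pc : P c.
  have [c_eq|c_neq] := eqVneq c 0; first by rewrite c_eq.
  have cpos : 0 < c by rewrite lt_neqAle eq_sym c_neq.
  have [[_ _ yd] _] := cl.
  have [d1 d2] := yd c cpos cT.
  have lc (y z : R -> 'cV[R]_n) dy dz : is_derive c 1 y dy -> is_derive c 1 z dz ->
      (forall t, 0 <= t -> t < c -> y t = z t) -> y c = z c.
    move=> yc zc yz.
    have yl : y t @[t --> c^'-] --> y c.
      by apply: cvg_at_left_filter; exact: (is_derive_continuous yc).
    have zl : z t @[t --> c^'-] --> z c.
      by apply: cvg_at_left_filter; exact: (is_derive_continuous zc).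
    have zl' : y t @[t --> c^'-] --> z c.
      apply: (cvg_trans _ zl); apply: near_eq_cvg; near=> t.
      by apply/esym/yz; near: t; [exact: nbhs_left_ge|exact: nbhs_left_lt].
    exact: (cvg_unique _ yl zl').
  have sdc k : is_derive c 1 (s^~ k) (field (s c) k) by exact: sd.
  split.
    by apply: (lc _ (fun t => position (s t)) _ _ d1 (position_derive sdc)) => t t0 /(Plt _ t0)[].
  by apply: (lc _ (fun t => velocity (s t)) _ _ d2 (velocity_derive sdc)) => t t0 /(Plt _ t0)[].
have Ple z : 0 <= z -> z <= c -> P z.
  by move=> z0; rewrite le_eqVlt => /predU1P[->//|]; exact: Plt.
suff <- : c = t1 by exact: Pc.
apply/eqP; rewrite eq_le ct1 leNgt; apply/negP => clt.
have [e e0 He] := agreement_step c0 clt t1T Pc.1 Pc.2.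
pose d := Num.min e (t1 - c).
have d0 : 0 < d by rewrite lt_min e0 subr_gt0.
have : A (c + d).
  split.
    rewrite addr_ge0 ?(ltW d0)//= -lerBrDl ge_min lexx orbT//.
  move=> z /andP[z0 zcd]; have [zc|/ltW cz] := leP z c; first exact: Ple.
  by apply: He; rewrite cz (le_trans zcd)// lerD2l ge_min lexx.
move=> /(ub_le_sup supA.2); rewrite -/c; lra.
Unshelve. all: by end_near. Qed.

End Trajectories.

(** * Safe stabilization *)

Theorem theorem1 (R : realType) (n : nat)
    (g1 : 'cV[R]_n -> 'M[R]_n)
    (f2 : 'cV[R]_n * 'cV[R]_n -> 'cV[R]_n)
    (g2 : 'cV[R]_n * 'cV[R]_n -> 'M[R]_n)
    (xb1 xb2 : 'cV[R]_n) (sigma : 'I_n -> R -> R)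
    (x10 x20 x1d : 'cV[R]_n) (k1 k2 : R)
    (hg1 : continuously_differentiable g1)
    (hf2 : continuously_differentiable f2)
    (hg2 : continuously_differentiable g2)
    (hxb1 : forall i, 0 < xb1 i 0) (hxb2 : forall i, 0 < xb2 i 0)
    (hf20 : forall x1 x2 : 'cV[R]_n, f2 (x1, x2) = 0 <-> x2 = 0)
    (hns : forall x1 x2 : 'cV[R]_n, safe xb1 xb2 (x1, x2) ->
       g1 x1 \in unitmx /\ g2 (x1, x2) \in unitmx)
    (hsigma : forall i, strictly_increasing_sigmoid (sigma i))
    (hx0 : safe xb1 xb2 (x10, x20))
    (hx1d : forall i, `|x1d i 0| < xb1 i 0)
    (hk1 : 0 < k1) (hk2 : k2 = k1^-1) :
  exists u x1 x2 : R -> 'cV[R]_n,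
    [/\ closed_loop sigma g1 f2 g2 xb1 xb2 k1 k2 x1d +oo%E u x1 x2,
        x1 0 = x10 /\ x2 0 = x20,
        (* every closed-loop solution from the same initial state is a
           restriction of this one *)
        forall (T : \bar R) (v y1 y2 : R -> 'cV[R]_n),
          closed_loop sigma g1 f2 g2 xb1 xb2 k1 k2 x1d T v y1 y2 ->
          y1 0 = x10 -> y2 0 = x20 ->
          forall t : R, 0 <= t -> (t%:E < T)%E ->
            y1 t = x1 t /\ y2 t = x2 t,
        [/\ lifted sigma xb1 (x1 t) @[t --> +oo] --> lifted sigma xb1 x1d,
            lifted sigma xb2 (x2 t) @[t --> +oo] --> (0 : 'cV[R]_n),
            u t @[t --> +oo] --> (0 : 'cV[R]_n) &
            x1 t @[t --> +oo] --> x1d] &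
        forall t : R, 0 <= t -> safe xb1 xb2 (x1 t, x2 t)].
Proof.
have k20 : 0 < k2 by rewrite hk2 invr_gt0.
pose pos := position sigma xb1 x1d.
pose vel := velocity sigma xb2.
pose s0 := state_of sigma xb1 xb2 x1d x10 x20.
have hunit (s : @state R n) : g1 (pos s) \in unitmx.
  by have [] := hns _ _ (safe_state x1d hsigma hxb1 hxb2 s).
have [s [r [V [ss0 sr sd V0 Vd]]]] :=
  bounded_solution_exists xb1 xb2 x1d hsigma hg1 k20 s0.
have E1 : pos (s 0) = x10 by rewrite ss0; exact: position_state_of hx0.
have E2 : vel (s 0) = x20 by rewrite ss0; exact: velocity_state_of hx0.
pose u t := control sigma g1 f2 g2 xb1 xb2 k1 k2 x1d
  (lifted sigma xb1 (pos (s t))) (lifted sigma xb2 (vel (s t))).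
have inl0 := error_cvg0 hsigma hg1 k20 hxb2 hunit sr sd V0 Vd.
have inr0 := lifted_velocity_cvg0 hsigma hg1 k20 hxb2 hunit sr sd V0 Vd.
have fld0 := field_cvg0 hsigma hg1 k20 hxb2 hunit sr sd V0 Vd.
pose zd := lifted sigma xb1 x1d.
have pos_cvg : pos (s t) @[t --> +oo] --> x1d.
  apply/cvg_mxP => i j; rewrite (ord1 j).
  have posE t : pos (s t) i 0 = xb1 i 0 * sigma i ((xb1 i 0)^-1 * (s t (inl i) + zd i 0)).
    by rewrite mxE [_^-1 * _]mulrC.
  under eq_fun do rewrite posE.
  have zE : x1d i 0 = xb1 i 0 * sigma i ((xb1 i 0)^-1 * (0 + zd i 0)).
    have -> : (xb1 i 0)^-1 * (0 + zd i 0) = Defs.eta (sigma i) (x1d i 0 / xb1 i 0).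
      by rewrite add0r /zd liftedE mulKf// lt0r_neq0.
    rewrite (etaK (hsigma i)) ?ratio_lt1// mulrC divfK// lt0r_neq0//.
  rewrite zE; apply: cvgM; first exact: cvg_cst.
  have zc : (xb1 i 0)^-1 * (s t (inl i) + zd i 0) @[t --> +oo] -->
      (xb1 i 0)^-1 * (0 + zd i 0).
    by apply: cvgM; [exact: cvg_cst|apply: cvgD; [exact: inl0|exact: cvg_cst]].
  exact: (cvg_comp _ _ zc (@sigmoid_continuous _ _ (hsigma i) _)).
have vel_cvg : vel (s t) @[t --> +oo] --> (0 : 'cV[R]_n).
  apply/cvg_mxP => i j; rewrite (ord1 j) [(0 : 'cV[R]_n) i 0]mxE.
  have velE t : vel (s t) i 0 = xb2 i 0 * sigma i (s t (inr i)) by rewrite mxE.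
  under eq_fun do rewrite velE.
  apply: cvg0Ml; rewrite -(sigmoid0 (hsigma i)).
  exact: (cvg_comp _ _ (inr0 i) (@sigmoid_continuous _ _ (hsigma i) _)).
exists u, (fun t => pos (s t)), (fun t => vel (s t)); split.
- split; last by move=> t _ _ _; reflexivity.
  split.
  + apply: cvg_at_right_filter; apply: is_derive_continuous.
    exact: (position_derive hsigma hxb1 (fun k => sd 0 k (lexx _))).
  + apply: cvg_at_right_filter; apply: is_derive_continuous.
    exact: (velocity_derive f2 hsigma hxb1 hxb2 hk1 hk2 hns (fun k => sd 0 k (lexx _))).
  + move=> t t0 _; split.
      exact: (position_derive hsigma hxb1 (fun k => sd t k (ltW t0))).
    exact: (velocity_derive f2 hsigma hxb1 hxb2 hk1 hk2 hns (fun k => sd t k (ltW t0))).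
- by split.
- move=> T v y1 y2 cl y10 y20 t t0 tT.
  apply: (closed_loop_unique hsigma hxb1 hxb2 hg1 hk1 hk2 hns sr sd cl t0 tT).
    by rewrite y10 -E1.
  by rewrite y20 -E2.
- split; last exact: pos_cvg.
  + apply/cvg_mxP => i j; rewrite (ord1 j).
    under eq_fun do rewrite (lifted_position x1d hsigma hxb1).
    suff : s t (inl i) + zd i 0 @[t --> +oo] --> 0 + zd i 0 by rewrite add0r.
    by apply: cvgD; [exact: inl0|exact: cvg_cst].
  + apply/cvg_mxP => i j; rewrite (ord1 j) [(0 : 'cV[R]_n) i 0]mxE.
    under eq_fun do rewrite (lifted_velocity hsigma hxb2).
    exact: cvg0Ml.
  + have uE t : u t = invmx (g2 (pos (s t), vel (s t))) *m
       ((\col_i (xb2 i 0 * (((sigma i)^`())%classic (s t (inr i)) *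
           field sigma g1 xb1 xb2 x1d k2 (s t) (inr i)))) - f2 (pos (s t), vel (s t))).
      exact: control_inputE.
    under eq_fun do rewrite uE.
    have x_cvg : (pos (s t), vel (s t)) @[t --> +oo] --> (x1d, 0 : 'cV[R]_n).
      exact: (cvg_pair pos_cvg vel_cvg).
    have [g2d _] := hg2; have [f2d _] := hf2.
    have g2c := cvg_comp _ _ x_cvg (differentiable_continuous (g2d (x1d, 0))).
    have f2c := cvg_comp _ _ x_cvg (differentiable_continuous (f2d (x1d, 0))).
    have f20 : f2 (x1d, 0) = 0 by apply/hf20.
    rewrite -(mulmx0 _ (invmx (g2 (x1d, 0)))); apply: cvg_mulmx.
      apply: cvg_invmx => //.
      by have [] := hns x1d 0 _ => //; split=> //= i; rewrite mxE normr0.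
    suff w0 : (\col_i (xb2 i 0 * (((sigma i)^`())%classic (s t (inr i)) *
           field sigma g1 xb1 xb2 x1d k2 (s t) (inr i)))) @[t --> +oo] --> (0 : 'cV[R]_n).
      have := cvgB w0 f2c; rewrite f20 subr0. exact.
    apply/cvg_mxP => i j; rewrite (ord1 j) [(0 : 'cV[R]_n) i 0]mxE.
    under eq_fun do rewrite mxE.
    apply: cvg0Ml.
    have dc := cvg_comp _ _ (inr0 i) (@sigmoid_derive_continuous _ _ (hsigma i) 0).
    have := cvgM dc (fld0 (inr i)); rewrite mulr0; exact.
- by move=> t t0; exact: safe_state.
Qed.
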